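(* Let $\{\mathbf{x}^{(k)}\}_{k\ge 1}$ be the sequence generated by the Away-step Stochastic Frank-Wolfe algorithm (ASFW, described in the context, with the batch sizes $m^{(i)}=\lceil 1/(1-\rho)^{2i+2}\rceil$) for solving $\min_{\mathbf{x}\in\mathcal{P}}F(\mathbf{x})$, and let $F^*=\min_{\mathbf{x}\in\mathcal{P}}F(\mathbf{x})$. There exist a deterministic constant $C_2$ and a number $\beta$ with $0<\beta<\rho\le1/2$ such that $\mathbb{E}\{F(\mathbf{x}^{(k+1)})-F^*\}\le C_2(1-\beta)^{(k-1)/2}$ for every $k\ge1$, and, to obtain an $\epsilon$-accurate solution, ASFW requires $O((1/\epsilon)^{4\eta})$ stochastic gradient evaluations, where $$0<\eta=\frac{\log(1-\rho)}{\log(1-\beta)}<1.$$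
   Context: Problem. $\mathcal{P}=\{\mathbf{x}\in\mathbb{R}^p:\mathbf{C}\mathbf{x}\le\mathbf{d}\}$, with $\mathbf{C}\in\mathbb{R}^{m\times p}$ (rows $\mathbf{C}_i$) and $\mathbf{d}\in\mathbb{R}^m$, is a non-empty compact polyhedron; $V$ is its finite set of vertices, $D=\sup\{\|\mathbf{x}-\mathbf{y}\|:\mathbf{x},\mathbf{y}\in\mathcal{P}\}$ its diameter. For $i=1,\dots,n$, $f_i:\mathbb{R}^p\to\mathbb{R}$ is strongly convex with parameter $\sigma_i$ and has an $L_i$-Lipschitz continuous gradient. $F=\frac1n\sum_{i=1}^n f_i$, $\sigma_F=\min_i\sigma_i$, $L_F=\max_iL_i$. $\xi$ is uniform on $\{1,\dots,n\}$ and $f(i,\mathbf{x})=f_i(\mathbf{x})$. Constants. $\Omega_{\mathcal{P}}=\zeta/\phi$, where $\zeta=\min\{d_i-\mathbf{C}_i\mathbf{v}:\mathbf{v}\in V,\ i\in\{1,\dots,m\},\ d_i>\mathbf{C}_i\mathbf{v}\}$ and $\phi=\max_{i\in\{1,\dots,m\}\setminus I(V)}\|\mathbf{C}_i\|$, with $I(V)=\{i:\mathbf{C}_i\mathbf{v}=d_i\text{ for all }\mathbf{v}\in V\}$. $\rho=\min\{\frac12,\frac{\Omega_{\mathcal{P}}^2\sigma_F}{16N^2L_FD^2}\}$, where $N=p+1$ if the representation update below uses Carathéodory's theorem and $N=|V|$ otherwise. ASFW. Start from $\mathbf{x}^{(1)}\in V$, with weights $\mu^{(1)}_{\mathbf{x}^{(1)}}=1$,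 $\mu^{(1)}_{\mathbf{v}}=0$ for other $\mathbf{v}\in V$, and $U^{(1)}=\{\mathbf{x}^{(1)}\}$. At iteration $k=1,2,\dots$: (1) Draw $\xi_1,\dots,\xi_{m^{(k)}}$ i.i.d. copies of $\xi$ (independent of the past); set $F^{(k)}(\mathbf{x})=\frac1{m^{(k)}}\sum_{i=1}^{m^{(k)}}f(\xi_i,\mathbf{x})$, $\mathbf{g}^{(k)}=\nabla F^{(k)}(\mathbf{x}^{(k)})$ (this costs $m^{(k)}$ stochastic gradient evaluations), $L^{(k)}=\frac1{m^{(k)}}\sum_{i=1}^{m^{(k)}}L_{\xi_i}$. (2) Choose a vertex $\mathbf{p}^{(k)}\in\arg\min_{\mathbf{x}\in\mathcal{P}}\langle\mathbf{g}^{(k)},\mathbf{x}\rangle$ and $\mathbf{u}^{(k)}\in\arg\max_{\mathbf{v}\in U^{(k)}}\langle\mathbf{g}^{(k)},\mathbf{v}\rangle$. (3) If $\langle\mathbf{g}^{(k)},\mathbf{p}^{(k)}+\mathbf{u}^{(k)}-2\mathbf{x}^{(k)}\rangle\le0$, set $\mathbf{d}^{(k)}=\mathbf{p}^{(k)}-\mathbf{x}^{(k)}$, $\gamma^{(k)}_{\max}=1$; otherwise set $\mathbf{d}^{(k)}=\mathbf{x}^{(k)}-\mathbf{u}^{(k)}$, $\gamma^{(k)}_{\max}=\mu^{(k)}_{\mathbf{u}^{(k)}}/(1-\mu^{(k)}_{\mathbf{u}^{(k)}})$. (4) Set $\gamma^{(k)}=\min\{-\langle\mathbf{g}^{(k)},\mathbf{d}^{(k)}\rangle/(L^{(k)}\|\mathbf{d}^{(k)}\|^2),\gamma^{(k)}_{\max}\}$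 (with $\gamma^{(k)}=0$ if $\mathbf{d}^{(k)}=0$), or determine it by line search, $\gamma^{(k)}\in\arg\min_{0\le\gamma\le\gamma^{(k)}_{\max}}F^{(k)}(\mathbf{x}^{(k)}+\gamma\mathbf{d}^{(k)})$. Set $\mathbf{x}^{(k+1)}=\mathbf{x}^{(k)}+\gamma^{(k)}\mathbf{d}^{(k)}$. (5) Representation update. If $\mathbf{d}^{(k)}=\mathbf{x}^{(k)}-\mathbf{u}^{(k)}$ (away step): $\mu^{(k+1)}_{\mathbf{v}}=\mu^{(k)}_{\mathbf{v}}(1+\gamma^{(k)})$ for $\mathbf{v}\ne\mathbf{u}^{(k)}$, $\mu^{(k+1)}_{\mathbf{u}^{(k)}}=\mu^{(k)}_{\mathbf{u}^{(k)}}(1+\gamma^{(k)})-\gamma^{(k)}$. Otherwise: $\mu^{(k+1)}_{\mathbf{v}}=\mu^{(k)}_{\mathbf{v}}(1-\gamma^{(k)})$ for $\mathbf{v}\neq\mathbf{p}^{(k)}$, $\mu^{(k+1)}_{\mathbf{p}^{(k)}}=\mu^{(k)}_{\mathbf{p}^{(k)}}(1-\gamma^{(k)})+\gamma^{(k)}$. Then $U^{(k+1)}=\{\mathbf{v}\in V:\mu^{(k+1)}_{\mathbf{v}}>0\}$. Optionally, Carathéodory's theorem is then applied to replace this representation $\mathbf{x}^{(k+1)}=\sum_{\mathbf{v}\in U^{(k+1)}}\mu^{(k+1)}_{\mathbf{v}}\mathbf{v}$ by one using a subset of at most $p+1$ of these vertices. Meaning of the complexity claim. ''Requires $O((1/\epsilon)^{4\eta})$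 stochastic gradient evaluations to obtain an $\epsilon$-accurate solution'' means: there are $C,\epsilon_0>0$ such that for every $\epsilon\in(0,\epsilon_0)$ there is $k\ge1$ with $\mathbb{E}\{F(\mathbf{x}^{(k+1)})-F^*\}\le\epsilon$ and $\sum_{i=1}^k m^{(i)}\le C(1/\epsilon)^{4\eta}$.
   Formalization: β<ρ and η<1 are incompatible as printed (β<ρ forces η>1). Proved instead: the whole claim with 0<β<ρ≤1/2 and 0<η (no η<1), and the whole claim with 0<η<1 and 0<β<1 (no β<ρ), possibly with different C₂, β. If D=0, ρ is read as 1/2. *)

(* Defs.v *)
From HB Require Import structures.
From mathcomp Require Export all_boot all_order all_algebra.
From mathcomp Require Export finmap.
From mathcomp Require Export all_classical all_reals all_analysis.

Set Implicit Arguments.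
Unset Strict Implicit.
Unset Printing Implicit Defensive.

Export Order.TTheory GRing.Theory Num.Theory.
Export numFieldNormedType.Exports.

Local Open Scope classical_set_scope.
Local Open Scope ring_scope.

Section Euclidean.
Context {R : realType} {p : nat}.
Implicit Types (x y : 'cV[R]_p) (f : 'cV[R]_p -> R).

Definition dot x y : R := \sum_(j < p) x j 0 * y j 0.

(* The library's norm on matrices is the sup norm; its topology is the usual
   one, so only the norm has to be redefined. *)
Definition enorm x : R := Num.sqrt (dot x x).

Definition grad f x : 'cV[R]_p := \col_j 'D_(delta_mx j 0) f x.

Definition strongly_convex (sigma : R) f :=
  0 < sigma /\
  forall x y (t : R), 0 <= t <= 1 ->
    f (t *: x + (1 - t) *: y) <=
      t * f x + (1 - t) * f y - sigma / 2 * t * (1 - t) * enorm (x - y) ^+ 2.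

Definition lipschitz_gradient (L : R) f :=
  (forall x, differentiable f x) /\
  forall x y, enorm (grad f x - grad f y) <= L * enorm (x - y).

End Euclidean.

Section Polyhedron.
Context {R : realType} {m p : nat} (C : 'M[R]_(m, p)) (d : 'cV[R]_m).

Definition polyhedron : set 'cV[R]_p :=
  [set x | forall i, (C *m x) i 0 <= d i 0].

Definition vertices : set 'cV[R]_p :=
  [set v | polyhedron v /\
    forall x y (t : R), polyhedron x -> polyhedron y -> 0 < t < 1 ->
      v = t *: x + (1 - t) *: y -> x = v /\ y = v].

Definition diameter : R :=
  sup [set r | exists x y, [/\ polyhedron x, polyhedron y & r = enorm (x - y)]].

Definition always_active : set 'I_m :=
  [set i | forall v, vertices v -> (C *m v) i 0 = d i 0].

(* [zeta] and [phi] are taken over finite sets of reals, where [inf] and [sup]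
   are the minimum and the maximum; the sets are nonempty as soon as the
   polyhedron has at least two points. *)
Definition zeta : R :=
  inf [set r | exists v i, [/\ vertices v, (C *m v) i 0 < d i 0 &
                               r = d i 0 - (C *m v) i 0]].

Definition phi : R :=
  sup [set r | exists i, ~ always_active i /\ r = enorm (row i C)^T].

Definition Omega : R := zeta / phi.

End Polyhedron.

Section Constants.
Context {R : realType} {m p n : nat}.
Variables (C : 'M[R]_(m, p)) (d : 'cV[R]_m) (sigma L : 'I_n -> R).

Definition sigmaF : R := inf (range sigma).

Definition LF : R := sup (range L).

Definition rep_size (caratheodory : bool) : nat :=
  if caratheodory then p.+1 else (#|` fset_set (vertices C d) |)%fset.

(* When the polyhedron is a single point the second term of the minimum is a
   division by zero, read as +oo (in MathComp, [x / 0 = 0]). *)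
Definition rho (caratheodory : bool) : R :=
  if diameter C d == 0 then 2^-1
  else Num.min 2^-1
         (Omega C d ^+ 2 * sigmaF /
            (16 * (rep_size caratheodory)%:R ^+ 2 * LF * diameter C d ^+ 2)).

Definition batch_size (caratheodory : bool) (k : nat) : nat :=
  `|Num.ceil (1 / (1 - rho caratheodory) ^+ (2 * k + 2))|%N.

End Constants.

Section Problem.
Context {R : realType} {p n : nat} (f : 'I_n -> 'cV[R]_p -> R).

Definition objective (x : 'cV[R]_p) : R := n%:R^-1 * \sum_i f i x.

Definition optimum (S : set 'cV[R]_p) : R := inf (objective @` S).

Definition batch_objective (N : nat) (s : 'I_N -> 'I_n) (x : 'cV[R]_p) : R :=
  N%:R^-1 * \sum_i f (s i) x.

Definition batch_lipschitz (L : 'I_n -> R) (N : nat) (s : 'I_N -> 'I_n) : R :=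
  N%:R^-1 * \sum_i L (s i).

End Problem.

Section Step.
Context {R : realType} {m p : nat} (C : 'M[R]_(m, p)) (d : 'cV[R]_m).
Implicit Types (x v w u dir : 'cV[R]_p) (mu nu : 'cV[R]_p -> R) (g : 'cV[R]_p).
Implicit Types (G : 'cV[R]_p -> R) (gam gmax Lk : R).

Let P := polyhedron C d.
Let V := vertices C d.

(* Weight functions are only relevant on the vertices. *)
Definition active mu : set 'cV[R]_p := [set v | V v /\ 0 < mu v].

Definition is_fw_vertex g w := V w /\ forall x, P x -> dot g w <= dot g x.

Definition is_away_vertex g mu u :=
  active mu u /\ forall v, active mu v -> dot g v <= dot g u.

Definition short_step g dir Lk gmax : R :=
  if dir == 0 then 0
  else Num.min (- dot g dir / (Lk * enorm dir ^+ 2)) gmax.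

Definition is_line_search G x dir gmax gam :=
  0 <= gam <= gmax /\
  forall gam', 0 <= gam' <= gmax -> G (x + gam *: dir) <= G (x + gam' *: dir).

Definition fw_weights mu w gam v : R :=
  if v == w then mu v * (1 - gam) + gam else mu v * (1 - gam).

Definition away_weights mu u gam v : R :=
  if v == u then mu v * (1 + gam) - gam else mu v * (1 + gam).

Definition is_representation x mu :=
  [/\ forall v, V v -> 0 <= mu v,
      \sum_(v \in V) mu v = 1 &
      \sum_(v \in V) mu v *: v = x].

(* [nu] are the weights after the away-step / Frank-Wolfe update and [mu'] the
   ones that are kept for the next iteration, at the new iterate [x']. *)
Definition representation_update (caratheodory : bool) x' nu mu' :=
  if caratheodory then
    [/\ is_representation x' mu', active mu' `<=` active nu &
        (active mu' #<= `I_p.+1)%card]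
  else forall v, V v -> mu' v = nu v.

(* One iteration, from the iterate [x] with weights [mu] to [x'] with weights
   [mu'], for the sampled objective [G] and sampled Lipschitz constant [Lk].
   It is a relation: ties, the step-size rule and the new representation are
   left open. *)
Definition asfw_step (caratheodory : bool) G Lk x mu x' mu' :=
  exists w u gam,
    let g := grad G x in
    let fw := dot g (w + u - 2 *: x) <= 0 in
    let dir := if fw then w - x else x - u in
    let gmax := if fw then 1 else mu u / (1 - mu u) in
    let nu := if fw then fw_weights mu w gam else away_weights mu u gam in
    [/\ is_fw_vertex g w,
        is_away_vertex g mu u,
        gam = short_step g dir Lk gmax \/ is_line_search G x dir gmax gam,
        x' = x + gam *: dir &
        representation_update caratheodory x' nu mu'].

End Step.

Section Sampling.
Context {d : measure_display} {T : measurableType d} {R : realType}.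
Variable Pr : probability T R.

Definition independent_family (n N : nat) (s : 'I_N -> T -> 'I_n) :=
  forall (J : {set 'I_N}) (A : 'I_N -> set 'I_n),
    Pr (\bigcap_(i in [set` J]) (s i @^-1` A i)) =
    (\prod_(i in J) Pr (s i @^-1` A i))%E.

Definition iid_uniform (n N : nat) (s : 'I_N -> T -> 'I_n) :=
  [/\ forall i j, measurable (s i @^-1` [set j]),
      forall i j, Pr (s i @^-1` [set j]) = (n%:R^-1)%:E &
      independent_family s].

Definition independent_of (H : set (set T)) (n N : nat)
    (s : 'I_N -> T -> 'I_n) :=
  forall (B : set T) (Q : set ('I_N -> 'I_n)), H B ->
    Pr (B `&` [set t | Q (s ^~ t)]) = (Pr B * Pr [set t | Q (s ^~ t)])%E.

Definition measurable_wrt (H : set (set T)) (X : T -> R) :=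
  forall B, measurable B -> H (X @^-1` B).

End Sampling.

(* A run of the algorithm, iterations being numbered from 1. [Past k] is the
   sigma-algebra of the events known before the batch of iteration [k] is
   drawn; it may contain more than the history of the run, e.g. the randomness
   used to break ties. *)
Record asfw_run {dT : measure_display} {T : measurableType dT} {R : realType}
    (Pr : probability T R) {m p n : nat}
    (C : 'M[R]_(m, p)) (d : 'cV[R]_m)
    (f : 'I_n -> 'cV[R]_p -> R) (sigma L : 'I_n -> R) (caratheodory : bool)
    (Past : nat -> set (set T)) (xi : nat -> nat -> T -> 'I_n)
    (x : nat -> T -> 'cV[R]_p) (mu : nat -> T -> 'cV[R]_p -> R) : Prop := {
  past_sigma_algebra : forall k, (1 <= k)%N ->
    sigma_algebra [set: T] (Past k) /\ Past k `<=` measurable;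
  past_nondecreasing : forall k, (1 <= k)%N -> Past k `<=` Past k.+1;
  past_samples : forall k j i l, (1 <= j < k)%N ->
    (i < batch_size C d sigma L caratheodory j)%N ->
    Past k (xi j i @^-1` [set l]);
  past_iterate : forall k j, (1 <= k)%N ->
    measurable_wrt (Past k) (fun t => x k t j 0);
  past_weights : forall k v, (1 <= k)%N -> vertices C d v ->
    measurable_wrt (Past k) (fun t => mu k t v);
  samples_iid : forall k, (1 <= k)%N ->
    iid_uniform Pr
      (fun i : 'I_(batch_size C d sigma L caratheodory k) => xi k i);
  samples_independent : forall k, (1 <= k)%N ->
    independent_of Pr (Past k)
      (fun i : 'I_(batch_size C d sigma L caratheodory k) => xi k i);
  run_start : forall t, vertices C d (x 1%N t) /\
    forall v, vertices C d v -> mu 1%N t v = (v == x 1%N t)%:R;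
  run_step : forall k t, (1 <= k)%N ->
    let s (i : 'I_(batch_size C d sigma L caratheodory k)) := xi k i t in
    asfw_step C d caratheodory (batch_objective f s) (batch_lipschitz L s)
      (x k t) (mu k t) (x k.+1 t) (mu k.+1 t)
}.

Section Guarantees.
Context {dT : measure_display} {T : measurableType dT} {R : realType}.
Variables (Pr : probability T R) (gap : nat -> T -> R).

(* [gap k] is the optimality gap of the [k]-th iterate. *)
Definition linear_rate (C2 beta : R) :=
  forall k, (1 <= k)%N ->
    ('E_Pr[gap k.+1] <= (C2 * (1 - beta) `^ ((k%:R - 1) / 2))%:E)%E.

(* [b i] stochastic gradients are evaluated at iteration [i]. *)
Definition evaluations_bigO (b : nat -> nat) (a : R) :=
  exists K eps0, [/\ 0 < K, 0 < eps0 &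
    forall eps, 0 < eps < eps0 -> exists k, [/\ (1 <= k)%N,
      ('E_Pr[gap k.+1] <= eps%:E)%E &
      (\sum_(1 <= i < k.+1) b i)%:R <= K * (1 / eps) `^ a]].

End Guarantees.

Definition eta {R : realType} (rho beta : R) : R := ln (1 - rho) / ln (1 - beta).

(* Main.v *)
(* Each sampled objective is smooth and strongly convex.  Moving as much mass as
   possible from a vertex representation of x onto one of y, greedily, leaves at
   most N |x - y| / Omega mass to move, so the away gap <g, u - p> is at least
   Omega <g, x - y> / (N |x - y|).  Hence a step that is not a drop step contracts
   the optimality gap of the sampled objective by the factor 1 - 4 tau, where tau
   is the second term in the minimum defining rho, while a drop step removes a
   vertex from the representation.  Weighting the gap by q to the power minus the
   number of active vertices, with q^2 = 1 - beta, turns both kinds of step into a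
   contraction by q.  As there are only n functions f_i, bounded on the polyhedron,
   sup |F^(k) - F| is at most a constant times the sum over i of the deviations of
   the empirical frequency of i from 1/n, whose mean is O(m_k^(-1/2)), that is
   O((1 - rho)^k), and no covering argument is needed.  Since Omega <= D gives
   tau <= 1/16, one may take beta = 3/2 rho: then (1 - rho)^2 < 1 - beta and the
   noise is dominated.  This yields the rate for a beta larger than rho, hence also
   for every smaller beta. *)
Require Import Defs.
From mathcomp Require Import ring lra zify.

Set Implicit Arguments.
Unset Strict Implicit.
Unset Printing Implicit Defensive.

Local Open Scope classical_set_scope.
Local Open Scope ring_scope.

(** * Euclidean geometry and first-order bounds *)

Section EuclideanTheory.
Context {R : realType} {p : nat}.
Implicit Types (x y z v : 'cV[R]_p) (a : R).

Lemma dotC x y : dot x y = dot y x.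
Proof. by apply: eq_bigr => j _; rewrite mulrC. Qed.

Lemma dotDl x y z : dot (x + y) z = dot x z + dot y z.
Proof. by rewrite /dot -big_split; apply: eq_bigr => j _; rewrite mxE mulrDl. Qed.

Lemma dotZl a x y : dot (a *: x) y = a * dot x y.
Proof. by rewrite /dot mulr_sumr; apply: eq_bigr => j _; rewrite mxE mulrA. Qed.

Lemma dotDr x y z : dot z (x + y) = dot z x + dot z y.
Proof. by rewrite dotC dotDl !(dotC z). Qed.

Lemma dotZr a x y : dot x (a *: y) = a * dot x y.
Proof. by rewrite dotC dotZl dotC. Qed.

Lemma dotNr x y : dot x (- y) = - dot x y.
Proof. by rewrite -scaleN1r dotZr mulN1r. Qed.

Lemma dotNl x y : dot (- x) y = - dot x y.
Proof. by rewrite dotC dotNr dotC. Qed.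

Lemma dotBr x y z : dot z (x - y) = dot z x - dot z y.
Proof. by rewrite dotDr dotNr. Qed.

Lemma dotBl x y z : dot (x - y) z = dot x z - dot y z.
Proof. by rewrite dotDl dotNl. Qed.

Lemma dot0r x : dot x 0 = 0.
Proof. by rewrite -(scale0r x) dotZr mul0r. Qed.

Lemma dot_sumr (I : Type) (r : seq I) (F : I -> 'cV[R]_p) x :
  dot x (\sum_(i <- r) F i) = \sum_(i <- r) dot x (F i).
Proof.
elim: r => [|i r IH]; first by rewrite !big_nil dot0r.
by rewrite !big_cons dotDr IH.
Qed.

Lemma dot_suml (I : Type) (r : seq I) (F : I -> 'cV[R]_p) x :
  dot (\sum_(i <- r) F i) x = \sum_(i <- r) dot (F i) x.
Proof. by rewrite dotC dot_sumr; apply: eq_bigr => i _; rewrite dotC. Qed.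

Lemma dotxx_ge0 x : 0 <= dot x x.
Proof. by apply: sumr_ge0 => j _; rewrite -expr2 sqr_ge0. Qed.

Lemma dotxx_eq0 x : dot x x = 0 -> x = 0.
Proof.
move=> /eqP; rewrite psumr_eq0 => [/allP x0|j _]; last by rewrite -expr2 sqr_ge0.
apply/matrixP => j k; rewrite ord1 mxE.
by have := x0 j (mem_index_enum _); rewrite mulf_eq0 orbb => /eqP.
Qed.

Lemma enorm_ge0 x : 0 <= enorm x.
Proof. exact: sqrtr_ge0. Qed.

Lemma sqr_enorm x : enorm x ^+ 2 = dot x x.
Proof. by rewrite sqr_sqrtr // dotxx_ge0. Qed.

Lemma enorm_eq0 x : enorm x = 0 -> x = 0.
Proof. by move=> x0; apply: dotxx_eq0; rewrite -sqr_enorm x0 expr0n. Qed.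

Lemma enorm_gt0 x : x != 0 -> 0 < enorm x.
Proof.
by move=> x0; rewrite lt_neqAle enorm_ge0 andbT eq_sym; apply: contra_neq x0 => /enorm_eq0.
Qed.

Lemma enorm0 : enorm (0 : 'cV[R]_p) = 0.
Proof. by rewrite /enorm dot0r sqrtr0. Qed.

Lemma enormZ a x : enorm (a *: x) = `|a| * enorm x.
Proof. by rewrite /enorm dotZl dotZr mulrA -expr2 sqrtrM ?sqr_ge0 // sqrtr_sqr. Qed.

Lemma enormN x : enorm (- x) = enorm x.
Proof. by rewrite -scaleN1r enormZ normrN1 mul1r. Qed.

Lemma enormB x y : enorm (x - y) = enorm (y - x).
Proof. by rewrite -enormN opprB. Qed.

Lemma cauchy_schwarz x y : dot x y <= enorm x * enorm y.
Proof.
have [y0|y0] := eqVneq (dot y y) 0.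
  by rewrite (dotxx_eq0 y0) dot0r mulr_ge0 // enorm_ge0.
have yp : 0 < dot y y by rewrite lt_neqAle eq_sym y0 dotxx_ge0.
have: 0 <= dot (dot y y *: x - dot x y *: y) (dot y y *: x - dot x y *: y).
  exact: dotxx_ge0.
rewrite dotBl !dotBr !dotZl !dotZr (dotC y x) => H.
have {}H : 0 <= dot y y * (dot x x * dot y y - dot x y ^+ 2).
  by apply: le_trans H _; rewrite le_eqVlt; apply/orP; left; apply/eqP; ring.
rewrite pmulr_rge0 // subr_ge0 in H.
apply: le_trans (ler_norm _) _.
by rewrite -sqrtr_sqr /enorm -sqrtrM ?dotxx_ge0 // ler_wsqrtr.
Qed.

Lemma normr_dot x y : `|dot x y| <= enorm x * enorm y.
Proof.
by rewrite ler_norml cauchy_schwarz andbT lerNl -dotNl -(enormN x) cauchy_schwarz.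
Qed.

End EuclideanTheory.

(** * First-order consequences of smoothness and strong convexity *)

Section FirstOrder.
Context {R : realType} {p : nat}.
Implicit Types (x y v : 'cV[R]_p) (f : 'cV[R]_p -> R) (s L : R).

Lemma dot_grad f x v : differentiable f x -> dot (grad f x) v = 'D_v f x.
Proof.
move=> df; rewrite deriveE // [in RHS](matrix_sum_delta v) linear_sum.
apply: eq_bigr => j _; rewrite big_ord1 linearZ mxE deriveE //.
by rewrite mulrC.
Qed.

Lemma is_derive_line f x v (t : R) : (forall z, differentiable f z) ->
  is_derive t 1 (fun t : R => f (x + t *: v)) (dot (grad f (x + t *: v)) v).
Proof.
move=> df; rewrite dot_grad //.
have E : (fun h : R => h^-1 *: (((fun t : R => f (x + t *: v)) \o shift t) (h *: (1 : R)) -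
           f (x + t *: v))) =
         (fun h : R => h^-1 *: ((f \o shift (x + t *: v)) (h *: v) - f (x + t *: v))).
  apply/funext => h /=; congr (_ *: (f _ - _)).
  by rewrite [h *: 1]mulr1 scalerDl addrCA.
split; last by rewrite /derive E.
by rewrite /derivable E; exact: diff_derivable.
Qed.

(** The descent lemma, by monotonicity instead of integration: the auxiliary function [B] has a
    nonpositive derivative on the unit interval, by Cauchy-Schwarz and the Lipschitz bound, and
    comparing [B 1] with [B 0] gives the claim. *)
Lemma gradient_deviation f L x y : lipschitz_gradient L f ->
  `|f y - f x - dot (grad f x) (y - x)| <= L / 2 * enorm (y - x) ^+ 2.
Proof.
move=> [df lf]; set v := y - x; set g := grad f x.
(* Taking [s] equal to 1 and to -1 yields the two sides of the absolute value. *)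
suff H s : `|s| <= 1 -> s * (f y - f x - dot g v) <= L / 2 * enorm v ^+ 2.
  rewrite ler_norml; apply/andP; split.
    by have := H (-1); rewrite normrN1 lexx mulN1r => /(_ isT); rewrite lerNl.
  by have := H 1; rewrite normr1 lexx mul1r; exact.
move=> s1.
pose B (t : R) := s * (f (x + t *: v) - t * dot g v) - L / 2 * t ^+ 2 * enorm v ^+ 2.
pose B' (t : R) := s * (dot (grad f (x + t *: v)) v - dot g v) - L * t * enorm v ^+ 2.
have dB (t : R) : is_derive t 1 B (B' t).
  have := is_derive_line x v t df => dfl.
  by apply: is_derive_eq; rewrite /GRing.scale /= /B'; field.
have B'_le0 (t : R) : t \in `]0, 1[ -> B^`()%classic t <= 0.
  rewrite in_itv /= => /andP[t0 _]; rewrite derive1E derive_val /B' subr_le0.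
  rewrite -dotBl; apply: le_trans (ler_norm _) _; rewrite normrM.
  apply: le_trans (_ : 1 * (enorm (grad f (x + t *: v) - g) * enorm v) <= _).
    by apply: ler_pM => //; exact: normr_dot.
  rewrite mul1r expr2 mulrA ler_wpM2r ?enorm_ge0 //.
  apply: le_trans (lf _ _) _.
  by rewrite addrAC subrr add0r enormZ gtr0_norm // mulrA.
have dvB : forall t : R, t \in `]0, 1[ -> derivable B t 1 by move=> t _; exact: ex_derive.
have cB : {within `[0%R, 1%R], continuous B}.
  by apply: derivable_within_continuous => t _.
have := ler0_derive1_nincr dvB B'_le0 cB (lexx 0) ler01 (lexx 1).
have -> : y = x + v by rewrite /v addrC subrK.
by rewrite /B scale1r scale0r addr0; lra.
Qed.

Lemma smooth_upper f L x y : lipschitz_gradient L f ->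
  f y <= f x + dot (grad f x) (y - x) + L / 2 * enorm (y - x) ^+ 2.
Proof.
move=> lf; have := gradient_deviation x y lf.
by rewrite ler_norml => /andP[_]; lra.
Qed.

(* The difference quotient along [x, y] is controlled by the smoothness lower
   bound, so no limit is needed: let t tend to 0 in the final inequality. *)
Lemma strongly_convex_lower f L s x y :
  lipschitz_gradient L f -> strongly_convex s f ->
  f x + dot (grad f x) (y - x) + s / 2 * enorm (y - x) ^+ 2 <= f y.
Proof.
move=> lf [s0 cf]; set v := y - x; set e := enorm v ^+ 2.
set c := f x + dot (grad f x) v + s / 2 * e - f y.
have e0 : 0 <= e by rewrite sqr_ge0.
have H t : 0 < t <= 1 -> c <= t * ((L + s) / 2 * e).
  move=> /andP[t0 t1].
  have := cf y x t; rewrite t1 (ltW t0) => /(_ isT).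
  have := gradient_deviation x (t *: y + (1 - t) *: x) lf.
  have -> : t *: y + (1 - t) *: x - x = t *: v.
    by apply/matrixP => i j; rewrite !mxE; ring.
  rewrite ler_norml dotZr enormZ exprMn -/e gtr0_norm // => /andP[+ _].
  rewrite -/v -/e => H1 H2.
  rewrite -(ler_pM2l t0); rewrite /c.
  have te0 : 0 <= t * (t * e) by apply: mulr_ge0; [|apply: mulr_ge0]; try exact: ltW.
  nra.
rewrite -subr_ge0 -oppr_le0 opprB.
suff : c <= 0 by rewrite /c; lra.
rewrite leNgt; apply/negP => c0.
set K := (L + s) / 2 * e in H.
have K0 : 0 < K.
  by have := H 1; rewrite ltr01 lexx mul1r => /(_ isT) /(lt_le_trans c0).
have cK : c <= K by have := H 1; rewrite ltr01 lexx mul1r; exact.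
have K2 : 0 < 2 * K by rewrite mulr_gt0.
(* At this value of [t] the bound [H] reads [c <= c / 2], against [0 < c]. *)
have t01 : 0 < c / (2 * K) <= 1.
  by rewrite divr_gt0 //= ler_pdivrMr // mul1r; lra.
have := H _ t01.
have -> : c / (2 * K) * K = c / 2 by field; rewrite lt0r_neq0.
lra.
Qed.

(** The upper and lower quadratic bounds are compared at one nonzero displacement; in dimension zero
    the two constants are unrelated. *)
Lemma strongly_convex_le_smooth f L s v : v != 0 ->
  lipschitz_gradient L f -> strongly_convex s f -> s <= L.
Proof.
move=> v0 lf cf.
have := smooth_upper 0 v lf; have := strongly_convex_lower 0 v lf cf.
rewrite subr0 => H1 H2; have : 0 < enorm v ^+ 2 by rewrite exprn_gt0 ?enorm_gt0.
nra.
Qed.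

End FirstOrder.

(** The form in which an iteration uses its sampled objective. Both bounds are linear in the
    function, its gradient and the constants, hence survive averaging over a batch. *)
Definition quadratic_bounds {R : realType} {p : nat} (s L : R)
    (f : 'cV[R]_p -> R) :=
  forall x y,
    f x + dot (grad f x) (y - x) + s / 2 * enorm (y - x) ^+ 2 <= f y /\
    f y <= f x + dot (grad f x) (y - x) + L / 2 * enorm (y - x) ^+ 2.

Section Averages.
Context {R : realType} {p n : nat} (f : 'I_n -> 'cV[R]_p -> R).
Variables (N : nat) (s : 'I_N -> 'I_n).
Hypothesis N_gt0 : (0 < N)%N.

Lemma grad_batch_objective x : (forall i z, differentiable (f i) z) ->
  grad (batch_objective f s) x = N%:R^-1 *: \sum_i grad (f (s i)) x.
Proof.
move=> df.
have E : batch_objective f s = N%:R^-1 *: (\sum_i f (s i)).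
  by apply/funext => z; rewrite /batch_objective fctE fct_sumE.
apply/matrixP => j k; rewrite !mxE summxE E deriveZ; last first.
  by apply: derivable_sum => i; exact: diff_derivable.
rewrite derive_sum; last by move=> i; exact: diff_derivable.
by congr (_ * _); apply: eq_bigr => i _; rewrite mxE.
Qed.

Lemma batch_quadratic_bounds (sigma : R) (L : 'I_n -> R) :
  (forall i, lipschitz_gradient (L i) (f i)) ->
  (forall i, quadratic_bounds sigma (L i) (f i)) ->
  quadratic_bounds sigma (batch_lipschitz L s) (batch_objective f s).
Proof.
move=> lf qf x y; rewrite grad_batch_objective => [|i]; last by case: (lf i).
rewrite dotZl dot_suml.
have N0 : 0 < N%:R :> R by rewrite ltr0n.
have mean_le (F G : 'I_N -> R) : (forall i, F i <= G i) ->
    N%:R^-1 * \sum_i F i <= N%:R^-1 * \sum_i G i.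
  by move=> FG; rewrite ler_wpM2l ?invr_ge0 // ler_sum.
have mean_cst (c : R) : N%:R^-1 * \sum_(i < N) c = c.
  by rewrite sumr_const card_ord -[c *+ N]mulr_natl mulKf // lt0r_neq0.
split.
- rewrite -[X in _ + X]mean_cst -!mulrDr -!big_split.
  by apply: mean_le => i; have [] := qf (s i) x y.
- rewrite /batch_lipschitz -[_ * _ / 2]mulrA -[_ * _ * _ ^+ 2]mulrA mulr_suml mulr_suml.
  rewrite -!mulrDr -!big_split.
  by apply: mean_le => i; have [] := qf (s i) x y.
Qed.

End Averages.

(** * Polyhedra and their vertices *)

(** Think of [e i] as the budget of resource [i] and of [s i v] as the amount consumed by a unit of
    [v]. The elements of [S] are served in turn, each as far as the remaining budgets allow, so one
    that is not fully served has met an exhausted budget. *)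
Lemma greedy_packing {R : realType} (T : eqType) (I : finType) (S : seq T)
    (s : I -> T -> R) (mu : T -> R) (e : I -> R) :
  uniq S -> (forall i v, v \in S -> 0 <= s i v) ->
  (forall v, v \in S -> 0 <= mu v) -> (forall i, 0 <= e i) ->
  exists kappa : T -> R,
    [/\ forall v, v \in S -> 0 <= kappa v <= mu v,
        forall i, \sum_(v <- S) kappa v * s i v <= e i &
        forall v, v \in S -> kappa v < mu v ->
          exists2 i, 0 < s i v & \sum_(w <- S) kappa w * s i w = e i].
Proof.
elim: S e => [|v S IH] e /=.
  move=> _ _ _ e0; exists (fun=> 0); split=> // i; by rewrite big_nil.
move=> /andP[vS uS] s0 mu0 e0.
(* The largest admissible amount of [v]; only the resources that [v] consumes can limit it. *)
pose t := \big[Num.min/mu v]_(i | 0 < s i v) (e i / s i v).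
have vin : v \in v :: S by rewrite mem_head.
have t0 : 0 <= t.
  by apply: le_bigmin => [|i si]; [exact: mu0 | rewrite divr_ge0 // ltW].
have tmu : t <= mu v by exact: bigmin_le_id.
have te i : t * s i v <= e i.
  have := s0 i v vin; rewrite le_eqVlt => /orP[/eqP <-|si]; first by rewrite mulr0.
  by rewrite -ler_pdivlMr //; exact: bigmin_le_cond.
have ttight : t < mu v -> exists2 i, 0 < s i v & t * s i v = e i.
  move=> tlt; have /bigmin_leP[mut|[i si Ei]] := lexx t; first by rewrite ltNge mut in tlt.
  by exists i => //; apply/eqP; rewrite eq_le te /= -ler_pdivrMr.
have [|||kap [k1 k2 k3]] := IH (fun i => e i - t * s i v) uS.
- by move=> i w wS; apply: s0; rewrite inE wS orbT.
- by move=> w wS; apply: mu0; rewrite inE wS orbT.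
- by move=> i; rewrite subr_ge0.
pose kap' w := if w == v then t else kap w.
have kapS (F : T -> R) : \sum_(w <- S) kap' w * F w = \sum_(w <- S) kap w * F w.
  apply: eq_big_seq => w wS; rewrite /kap'; case: eqP => // wv.
  by move: vS; rewrite -wv wS.
exists kap'; split.
- move=> w; rewrite inE /kap'; case: eqP => [-> _|_ /=]; first by rewrite t0.
  exact: k1.
- by move=> i; rewrite big_cons kapS {1}/kap' eqxx -lerBrDl.
- move=> w; rewrite inE {1}/kap'; case: eqP => [-> _|_ /= wS].
    (* A budget exhausted by [v] leaves nothing for the rest of the list, which must then consume
       zero of it: it stays exhausted. *)
    move=> /ttight[i si Ei]; exists i => //; rewrite big_cons kapS {1}/kap' eqxx Ei.
    suff -> : \sum_(j <- S) kap j * s i j = 0 by rewrite addr0.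
    apply/eqP; rewrite eq_le; apply/andP; split.
      by have := k2 i; rewrite Ei subrr.
    rewrite big_seq sumr_ge0 // => j jS; rewrite mulr_ge0 //.
      by have /andP[] := k1 _ jS.
    by apply: s0; rewrite inE jS orbT.
  move=> /(k3 _ wS)[i si Ei]; exists i => //.
  by rewrite big_cons kapS {1}/kap' eqxx Ei addrC subrK.
Qed.

(** Gives positivity to minima over finite families: step lengths inside the polyhedron, [zeta] and
    [sigmaF]. *)
Lemma positive_lower_bound {R : realType} (s : seq R) :
  exists2 e : R, 0 < e & forall r, r \in s -> 0 < r -> e <= r.
Proof.
elim: s => [|a s [e e0 IH]]; first by exists 1.
exists (if 0 < a then Num.min a e else e).
  by case: ifPn => // a0; rewrite lt_min a0.
move=> r; rewrite inE => /orP[/eqP -> a0|rs r0]; first by rewrite a0 ge_min lexx.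
by case: ifPn => _; rewrite ?ge_min IH ?orbT.
Qed.

Section PolyhedronTheory.
Context {R : realType} {m p : nat} (C : 'M[R]_(m, p)) (d : 'cV[R]_m).
Implicit Types (x y z v w g : 'cV[R]_p) (mu : 'cV[R]_p -> R).

Let P := polyhedron C d.
Let V := vertices C d.

Lemma mulmx_dot i x : (C *m x) i 0 = dot (row i C)^T x.
Proof. by rewrite mxE; apply: eq_bigr => j _; rewrite !mxE. Qed.

Lemma polyhedron_mean (S : seq 'cV[R]_p) mu x :
  (forall v, v \in S -> 0 <= mu v) -> (forall v, v \in S -> P v) ->
  \sum_(v <- S) mu v = 1 -> \sum_(v <- S) mu v *: v = x -> P x.
Proof.
move=> mu0 SP mu1 <- i; rewrite mulmx_dot dot_sumr.
rewrite -[leRHS]mul1r -mu1 mulr_suml big_seq [leRHS]big_seq.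
apply: ler_sum => v vS; rewrite dotZr ler_wpM2l ?mu0 //.
by rewrite -mulmx_dot SP.
Qed.

(** A ratio test: each of the finitely many constraints inactive at [y] has positive slack, which
    bounds the step from above only if [h] increases that constraint. *)
Lemma polyhedron_perturb y h : P y ->
  (forall i, (C *m y) i 0 = d i 0 -> (C *m h) i 0 <= 0) ->
  exists2 e : R, 0 < e & P (y + e *: h).
Proof.
move=> Py Hh.
have [e e0 He] := positive_lower_bound
  [seq (d i 0 - (C *m y) i 0) / (C *m h) i 0 | i <- enum 'I_m].
exists e => // i; rewrite mulmx_dot dotDr dotZr -!mulmx_dot.
have [hi|hi] := leP ((C *m h) i 0) 0.
  by rewrite (le_trans _ (Py i)) // gerDl mulr_ge0_le0 // ltW.
have si : 0 < d i 0 - (C *m y) i 0.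
  rewrite subr_gt0 lt_neqAle Py andbT; apply/eqP => /Hh.
  by rewrite leNgt hi.
rewrite -lerBrDl -ler_pdivlMr //; apply: He; last by rewrite divr_gt0.
by apply/mapP; exists i => //; rewrite mem_enum.
Qed.

(** If every constraint active at [v] were active at [w], the segment from [w] to [v] could be
    prolonged beyond [v] inside the polyhedron, and [v] would not be extreme. *)
Lemma vertex_separated v w : V v -> P w -> w <> v ->
  exists2 i, (C *m v) i 0 = d i 0 & (C *m w) i 0 < d i 0.
Proof.
move=> [Pv Vv] Pw wv; apply: contrapT => H.
have [i Ei|e e0 Pe] := @polyhedron_perturb v (v - w) Pv.
  rewrite mulmx_dot dotBr -!mulmx_dot Ei subr_le0 leNgt; apply/negP => wi.
  by apply: H; exists i.
have e1 : 0 < 1 + e by rewrite addr_gt0.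
have [||_ //] := Vv (v + e *: (v - w)) w (1 + e)^-1 Pe Pw.
  by rewrite invr_gt0 e1 invf_lt1 // ltrDl.
apply/matrixP => i j; rewrite !mxE; field; exact: lt0r_neq0.
Qed.

(** A vertex is determined by its set of active constraints. Sending all other points to [None]
    makes the vertices a preimage of a finite set, on which [act] is injective. *)
Lemma finite_vertices : finite_set V.
Proof.
pose act v : option {set 'I_m} :=
  if v \in V then Some [set i | (C *m v) i 0 == d i 0]%SET else None.
have -> : V = act @^-1` [set o | o].
  by apply/seteqP; split=> v /=; rewrite /act; [move=> /mem_set -> | case: ifPn => // /set_mem].
apply: finite_preimage; last exact: finite_finset.
move=> v w; rewrite !inE /= /act; case: ifPn => // /set_mem Vv _.
case: ifPn => // /set_mem Vw _ [] E; apply: contrapT => vw.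
have [||i vi wi] := @vertex_separated v w Vv; first by case: Vw.
  by move=> wv; apply: vw.
by move/setP/(_ i): E; rewrite !inE vi eqxx (lt_eqF wi).
Qed.

Lemma zeta_ge0 : 0 <= zeta C d.
Proof.
rewrite /zeta; set Z := [set _ | _].
have [->|/set0P Z0] := eqVneq Z set0; first by rewrite inf0.
by apply: lb_le_inf => // _ [v [i [_ vi ->]]]; rewrite subr_ge0 ltW.
Qed.

Lemma zeta_le v i : V v -> (C *m v) i 0 < d i 0 -> zeta C d <= d i 0 - (C *m v) i 0.
Proof.
move=> Vv vi; apply: ge_inf; last by exists v, i.
by exists 0 => _ [w [j [_ wj ->]]]; rewrite subr_ge0 ltW.
Qed.

Lemma zeta_gt0 v i : V v -> (C *m v) i 0 < d i 0 -> 0 < zeta C d.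
Proof.
move=> Vv vi.
have [e e0 He] := positive_lower_bound
  [seq d j 0 - (C *m w) j 0 | w <- enum_fset (fset_set V), j <- enum 'I_m].
apply: lt_le_trans e0 _; apply: lb_le_inf; first by exists (d i 0 - (C *m v) i 0), v, i.
move=> _ [w [j [Vw wj ->]]]; apply: He; last by rewrite subr_gt0.
apply/allpairsP; exists (w, j); split=> //=; last by rewrite mem_enum.
by rewrite (in_fset_set finite_vertices) inE.
Qed.

Lemma enorm_row_le_phi v i : V v -> (C *m v) i 0 < d i 0 ->
  enorm (row i C)^T <= phi C d.
Proof.
move=> Vv vi; apply: ub_le_sup; last first.
  by exists i; split=> // /(_ v Vv) E; rewrite E ltxx in vi.
exists (\sum_i enorm (row i C)^T) => _ [j [_ ->]].
by rewrite (bigD1 j) //= lerDl sumr_ge0 // => k _; exact: enorm_ge0.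
Qed.

Lemma phi_ge0 : 0 <= phi C d.
Proof.
rewrite /phi; set Z := [set _ | _].
have [->|/set0P [_ [i [ni _]]]] := eqVneq Z set0; first by rewrite sup0.
apply: le_trans (enorm_ge0 (row i C)^T) _; apply: ub_le_sup; last by exists i.
exists (\sum_i enorm (row i C)^T) => _ [j [_ ->]].
by rewrite (bigD1 j) //= lerDl sumr_ge0 // => k _; exact: enorm_ge0.
Qed.

Lemma Omega_ge0 : 0 <= Omega C d.
Proof. by rewrite divr_ge0 ?zeta_ge0 ?phi_ge0. Qed.

End PolyhedronTheory.

(** * Moving mass between vertex representations *)

Section Transport.
Context {R : realType} {m p : nat} (C : 'M[R]_(m, p)) (d : 'cV[R]_m).
Implicit Types (x y z v w g : 'cV[R]_p) (mu : 'cV[R]_p -> R).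

Let P := polyhedron C d.
Let V := vertices C d.

(** Of the weights [mu] as much as possible, [kap], is kept on its vertex towards a representation
    of [y]; the rest [a], of total [t], must move. Each unit moved costs at most [M], so the
    left-hand inner product is at most [t * M]. A vertex losing mass has a constraint whose slack at
    [y] is used up, which bounds its loss by [phi * enorm (x - y) / zeta]; summing over the support
    bounds [t]. *)
Lemma away_gap_bound (S : seq 'cV[R]_p) mu g x y M :
  uniq S -> (forall v, v \in S -> V v) -> (forall v, v \in S -> 0 <= mu v) ->
  \sum_(v <- S) mu v = 1 -> \sum_(v <- S) mu v *: v = x -> P y ->
  (forall v z, v \in S -> 0 < mu v -> P z -> dot g (v - z) <= M) ->
  Omega C d * dot g (x - y) <= (count (fun v => 0 < mu v) S)%:R * enorm (x - y) * M.
Proof.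
move=> uS SV mu0 mu1 mux Py gM; set N := count _ _.
have SP v : v \in S -> P v by move=> /SV[].
have [v0 v0S mv0] : exists2 v, v \in S & 0 < mu v.
  apply: contrapT => H; move: (oner_neq0 R); rewrite -mu1 big_seq big1 ?eqxx // => v vS.
  apply/eqP; rewrite eq_le mu0 // andbT leNgt; apply/negP => mv.
  by apply: H; exists v.
have M0 : 0 <= M by have := gM v0 v0 v0S mv0 (SP _ v0S); rewrite subrr dot0r.
(* The resources are the constraints: mass on [v] consumes its slack, and the budget is the slack of
   [y]. *)
have [i v vS|||kap [k1 k2 k3]] := @greedy_packing R _ _ S (fun i v => d i 0 - (C *m v) i 0)
    mu (fun i => d i 0 - (C *m y) i 0) uS.
- by rewrite subr_ge0 SP.
- exact: mu0.
- by move=> i; rewrite subr_ge0 Py.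
pose a v := mu v - kap v.
pose t := \sum_(v <- S) a v.
have a0 v : v \in S -> 0 <= a v by move=> /k1/andP[_]; rewrite subr_ge0.
have amu v : v \in S -> 0 < a v -> 0 < mu v.
  by move=> /k1/andP[k0 _]; rewrite subr_gt0; exact: le_lt_trans.
have t0 : 0 <= t by rewrite /t big_seq sumr_ge0.
have tE : t = 1 - \sum_(v <- S) kap v by rewrite /t sumrB mu1.
have slackE i (b : 'cV[R]_p -> R) : \sum_(v <- S) b v * (d i 0 - (C *m v) i 0) =
    (\sum_(v <- S) b v) * d i 0 - dot (row i C)^T (\sum_(v <- S) b v *: v).
  rewrite dot_sumr mulr_suml -sumrB; apply: eq_bigr => v _.
  by rewrite mulrBr dotZr -mulmx_dot.
(* For positive [t], the point [t^-1 *: z] is the destination of the moved mass; [Cz] below shows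
   that it is feasible. *)
pose z := y - \sum_(v <- S) kap v *: v.
have xyE : x - y = \sum_(v <- S) a v *: v - z.
  have -> : \sum_(v <- S) a v *: v = x - \sum_(v <- S) kap v *: v.
    by rewrite -mux -sumrB; apply: eq_bigr => v _; rewrite scalerBl.
  by rewrite /z opprB addrA subrK.
have Cz i : (C *m z) i 0 <= t * d i 0.
  rewrite mulmx_dot /z dotBr -mulmx_dot tE mulrBl mul1r.
  by have := k2 i; rewrite slackE; lra.
have a_le v : v \in S -> a v * zeta C d <=
    (0 < mu v)%R%:R * (phi C d * enorm (x - y)).
  move=> vS; have := a0 v vS; rewrite le_eqVlt => /orP[/eqP <-|av].
    by rewrite mul0r !mulr_ge0 ?phi_ge0 ?enorm_ge0.
  rewrite (amu v vS av) mul1r.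
  have [|i si Ei] := k3 v vS; first by rewrite -subr_gt0.
  rewrite subr_gt0 in si.
  apply: le_trans (_ : enorm (row i C)^T * enorm (x - y) <= _); last first.
    by rewrite ler_wpM2r ?enorm_ge0 // (enorm_row_le_phi (SV v vS)).
  rewrite enormB; apply: le_trans (cauchy_schwarz _ _).
  apply: le_trans (_ : a v * (d i 0 - (C *m v) i 0) <= _).
    by rewrite ler_wpM2l ?a0 // zeta_le //; exact: SV.
  (* As budget [i] is exhausted, the slack carried by the moved mass is exactly the slack of [x]
     minus that of [y]. *)
  have <- : \sum_(w <- S) a w * (d i 0 - (C *m w) i 0) = dot (row i C)^T (y - x).
    under eq_bigr do rewrite mulrBl.
    rewrite sumrB Ei slackE mu1 mux mul1r dotBr -!mulmx_dot; lra.
  rewrite (big_rem v) //= lerDl big_seq sumr_ge0 // => w /mem_rem wS.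
  by rewrite mulr_ge0 ?a0 // subr_ge0 SP.
have t_le : t * zeta C d <= N%:R * (phi C d * enorm (x - y)).
  have -> : N%:R = \sum_(v <- S) (0 < mu v)%R%:R :> R.
    rewrite /N -sum1_count big_mkcond natr_sum.
    by apply: eq_bigr => v _; case: (0 < mu v).
  rewrite /t !mulr_suml big_seq [leRHS]big_seq; exact: ler_sum.
have gt : dot g (x - y) <= t * M.
  rewrite xyE; have := t0; rewrite le_eqVlt => /orP[/eqP t00|tp].
    rewrite -t00 mul0r.
    have a00 v : v \in S -> a v = 0.
      move=> vS; apply/eqP; rewrite eq_le a0 // andbT t00 /t (big_rem v) //= lerDl.
      by rewrite big_seq sumr_ge0 // => w /mem_rem; exact: a0.
    rewrite big_seq big1 => [|v vS]; last by rewrite a00 // scale0r.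
    rewrite sub0r leNgt; apply/negP => gz.
    (* With no mass to move, [z] is a recession direction; following it from [v0] until the gap
       equals [M + 1] contradicts the bound [M]. *)
    pose l := (M + 1) / dot g (- z).
    have l0 : 0 < l by rewrite divr_gt0 // ltr_wpDl.
    have : P (v0 + l *: z).
      move=> i; rewrite mulmx_dot dotDr dotZr -!mulmx_dot.
      rewrite (le_trans _ (SP _ v0S i)) // gerDl mulr_ge0_le0 ?(ltW l0) //.
      by have := Cz i; rewrite -t00 mul0r.
    move=> /(gM v0 _ v0S mv0).
    rewrite opprD addrA subrr sub0r -scalerN dotZr /l divfK ?lt0r_neq0 //.
    by lra.
  have Pz : P (t^-1 *: z).
    by move=> i; rewrite mulmx_dot dotZr -mulmx_dot mulrC ler_pdivrMr // mulrC Cz.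
  have -> : \sum_(v <- S) a v *: v - z = \sum_(v <- S) a v *: (v - t^-1 *: z).
    under [RHS]eq_bigr do rewrite scalerBr.
    by rewrite sumrB -scaler_suml -/t scalerA divff ?lt0r_neq0 // scale1r.
  rewrite dot_sumr mulr_suml big_seq [leRHS]big_seq; apply: ler_sum => v vS.
  rewrite dotZr; have := a0 v vS; rewrite le_eqVlt => /orP[/eqP <-|av].
    by rewrite !mul0r.
  by rewrite ler_pM2l // gM // (amu v vS).
apply: le_trans (ler_wpM2l (Omega_ge0 C d) gt) _.
rewrite mulrA ler_wpM2r // /Omega.
(* If [phi] is zero, then so is [Omega], division by zero being zero. *)
have := phi_ge0 C d; rewrite le_eqVlt => /orP[/eqP <-|ph].
  by rewrite invr0 mulr0 mul0r mulr_ge0 ?enorm_ge0.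
by rewrite mulrAC ler_pdivrMr // mulrC (le_trans t_le) // mulrA mulrAC.
Qed.

End Transport.

(** * The diameter and its relation to [Omega] *)

Section Diameter.
Context {R : realType} {m p : nat} (C : 'M[R]_(m, p)) (d : 'cV[R]_m).
Implicit Types (x y z v w g : 'cV[R]_p).

Let P := polyhedron C d.
Let V := vertices C d.
Let D := diameter C d.
Hypothesis P_compact : compact P.

Lemma continuous_sqdist v : continuous (fun z : 'cV[R]_p => dot (z - v) (z - v)).
Proof.
have -> : (fun z => dot (z - v) (z - v)) =
    \sum_(j < p) (fun z => (z j 0 - v j 0) * (z j 0 - v j 0)).
  by apply/funext => z; rewrite fct_sumE; apply: eq_bigr => j _; rewrite !mxE.
elim/big_ind : _ => [|f g cf cg|j _] z.
- exact: cst_continuous.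
- by apply: continuousD; [exact: cf | exact: cg].
- have c : (fun z : 'cV[R]_p => z j 0 - v j 0) x @[x --> z] --> z j 0 - v j 0.
    by apply: cvgB; [exact: (@nbhs_filter _ z) | exact: coord_continuous | apply: cvg_cst; exact: (@nbhs_filter _ z)].
  apply: (cvgM c c).
Qed.

Lemma farthest_point v : P !=set0 ->
  exists2 z, P z & forall y, P y -> dot (y - v) (y - v) <= dot (z - v) (z - v).
Proof.
move=> P0; have [|z] := @compact_EVT_max _ _ (fun z => dot (z - v) (z - v)) P P0 P_compact.
  by apply: continuous_subspaceT; exact: continuous_sqdist.
by rewrite inE => Pz H; exists z => // y Py; apply: H; rewrite inE.
Qed.

(* The point of P farthest from v is extreme, by strict convexity of the norm. *)
Lemma another_vertex v y : P v -> P y -> y <> v -> exists2 w, V w & w <> v.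
Proof.
move=> Pv Py yv; have [|z Pz zmax] := @farthest_point v; first by exists v.
exists z.
  split=> // a b t Pa Pb /andP[t0 t1] zE.
  have : t * (1 - t) * dot (a - b) (a - b) <= 0.
    have := zmax a Pa; have := zmax b Pb.
    have -> : dot (z - v) (z - v) = t * dot (a - v) (a - v) +
        (1 - t) * dot (b - v) (b - v) - t * (1 - t) * dot (a - b) (a - b).
      rewrite zE !(dotBl, dotBr, dotDl, dotDr, dotZl, dotZr) (dotC v) (dotC b a) (dotC b v).
      ring.
    nra.
  rewrite pmulr_rle0 ?mulr_gt0 ?subr_gt0 // => ab.
  have /dotxx_eq0/subr0_eq E : dot (a - b) (a - b) = 0.
    by apply/eqP; rewrite eq_le ab dotxx_ge0.
  by rewrite zE E -scalerDl addrC subrK scale1r.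
move=> zv; have := zmax y Py; rewrite zv subrr dot0r => yv0.
apply: yv; apply/subr0_eq/dotxx_eq0/eqP.
by rewrite eq_le yv0 dotxx_ge0.
Qed.

Lemma has_ubound_dist :
  has_ubound [set r | exists x y, [/\ P x, P y & r = enorm (x - y)]].
Proof.
have [[v Pv]|P0] := pselect (P !=set0); last first.
  by exists 0 => r [x [y [Px _ _]]]; exfalso; apply: P0; exists x.
have [|z Pz zmax] := @farthest_point v; first by exists v.
(* By the parallelogram law the squared distance of two points is at most twice the sum of their
   squared distances to [v]. *)
exists (Num.sqrt (4 * dot (z - v) (z - v))) => _ [x [y [Px Py ->]]].
rewrite ler_wsqrtr //.
have := zmax x Px; have := zmax y Py; have := dotxx_ge0 (x + y - (v + v)).
by rewrite !(dotBl, dotBr, dotDl, dotDr) (dotC v) (dotC y) (dotC v y); lra.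
Qed.

Lemma enorm_le_diameter x y : P x -> P y -> enorm (x - y) <= D.
Proof. by move=> Px Py; apply: (ub_le_sup has_ubound_dist); exists x, y. Qed.

Lemma diameter_eq0 x y : D = 0 -> P x -> P y -> x = y.
Proof.
move=> D0 Px Py; apply/subr0_eq/enorm_eq0/eqP.
by rewrite eq_le enorm_ge0 andbT -D0 enorm_le_diameter.
Qed.

Lemma diameter_neq0 x : P x -> D != 0 -> exists2 y, P y & y <> x.
Proof.
move=> Px D0; apply: contrapT => H.
have Px1 y : P y -> y = x by move=> Py; apply: contrapT => yx; apply: H; exists y.
move/eqP: D0; apply; rewrite /D /diameter -(sup1 0); congr sup.
apply/seteqP; split=> [_ [a [b [Pa Pb ->]]]|_ -> /=].
  by rewrite (Px1 a Pa) (Px1 b Pb) subrr enorm0.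
by exists x, x; rewrite subrr enorm0.
Qed.

(** A second vertex [w] exists, and a constraint active at [v] but not at [w] makes [zeta] positive;
    its row is nonzero, so [phi] is positive too. *)
Lemma Omega_gt0 v : V v -> D != 0 -> 0 < Omega C d.
Proof.
move=> Vv D0; have Pv : P v by case: Vv.
have [y Py yv] := diameter_neq0 Pv D0.
have [w Vw wv] := another_vertex Pv Py yv.
have [|i vi wi] := vertex_separated Vv _ wv; first by case: Vw.
rewrite divr_gt0 ?(zeta_gt0 Vw wi) //.
apply: lt_le_trans (enorm_row_le_phi Vw wi); apply: enorm_gt0.
apply: contraTneq wi => Ci; rewrite -vi !mulmx_dot Ci.
by rewrite !(dotC 0) !dot0r ltxx.
Qed.

(** The transport bound for the one-vertex representation of [v], with direction [v - y] and with
    [M] obtained from Cauchy-Schwarz. *)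
Lemma Omega_le_diameter v : V v -> D != 0 -> Omega C d <= D.
Proof.
move=> Vv D0; have Pv : P v by case: Vv.
have [y Py yv] := diameter_neq0 Pv D0.
have gp : 0 < enorm (v - y).
  by apply: enorm_gt0; rewrite subr_eq0; apply/eqP => vy; apply: yv.
have := @away_gap_bound _ _ _ C d [:: v] (fun=> 1) (v - y) v y (enorm (v - y) * D).
rewrite !big_seq1 scale1r /= ltr01 => /(_ isT).
rewrite -sqr_enorm => H.
have : Omega C d * enorm (v - y) ^+ 2 <= 1 * enorm (v - y) * (enorm (v - y) * D).
  apply: H => // [w|w z].
    by rewrite inE => /eqP ->.
  rewrite inE => /eqP -> _ Pz; apply: le_trans (cauchy_schwarz _ _) _.
  by rewrite ler_wpM2l ?enorm_ge0 // enorm_le_diameter.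
by rewrite mul1r mulrA -expr2 mulrC ler_pM2l ?exprn_gt0.
Qed.

End Diameter.

(** * Convex representations *)

Lemma sum_pred1 (T : eqType) (M : nmodType) (S : seq T) (w : T) (F : T -> M) :
  uniq S -> w \in S -> \sum_(v <- S) (if v == w then F v else 0) = F w.
Proof.
move=> uS wS; rewrite (bigD1_seq w) //= eqxx big1 ?addr0 // => v /negbTE -> //.
Qed.

Section Representations.
Context {R : realType} {m p : nat} (C : 'M[R]_(m, p)) (d : 'cV[R]_m).
Implicit Types (x y z v w g : 'cV[R]_p) (mu nu : 'cV[R]_p -> R).

Let P := polyhedron C d.
Let V := vertices C d.

Definition vertex_seq : seq 'cV[R]_p := enum_fset (fset_set V).
Let S := vertex_seq.

Definition support_size mu : nat := count (fun v => 0 < mu v) S.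

Lemma mem_vertex_seq v : v \in S <-> V v.
Proof.
rewrite /S /vertex_seq (in_fset_set (finite_vertices C d)); split; first by move/set_mem.
by move=> Vv; apply/mem_set.
Qed.

Lemma vertex_seq_uniq : uniq S.
Proof. exact: fset_uniq. Qed.

Lemma is_representationE x mu : is_representation C d x mu <->
  [/\ forall v, v \in S -> 0 <= mu v, \sum_(v <- S) mu v = 1 &
      \sum_(v <- S) mu v *: v = x].
Proof.
rewrite /is_representation !fsbig_finite; try exact: finite_vertices.
split=> -[mu0 mu1 mux]; split=> // v.
  by move=> /mem_vertex_seq; exact: mu0.
by move=> Vv; apply: mu0; apply/mem_vertex_seq.
Qed.

Lemma representation_polyhedron x mu : is_representation C d x mu -> P x.
Proof.
move=> /is_representationE[mu0 mu1 mux].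
by apply: (@polyhedron_mean _ _ _ _ _ S mu) => // v /mem_vertex_seq[].
Qed.

Lemma support_size_active mu :
  support_size mu = (#|` fset_set (active C d mu) |)%fset.
Proof.
rewrite /support_size -size_filter; apply/esym/perm_size/uniq_perm.
- exact: fset_uniq.
- by rewrite filter_uniq // vertex_seq_uniq.
have fA : finite_set (active C d mu).
  by apply: sub_finite_set (finite_vertices C d) => v [].
move=> v; rewrite mem_filter (in_fset_set fA); apply/idP/andP.
  by move=> /set_mem[Vv mv]; split=> //; apply/mem_vertex_seq.
by move=> [mv /mem_vertex_seq Vv]; apply/mem_set.
Qed.

Lemma sub_support mu nu : active C d mu `<=` active C d nu ->
  (support_size mu <= support_size nu)%N.
Proof.
move=> mn; rewrite /support_size -!size_filter; apply: uniq_leq_size.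
  by rewrite filter_uniq // vertex_seq_uniq.
move=> v; rewrite !mem_filter => /andP[mv vS].
have [] := mn v; first by split=> //; apply/mem_vertex_seq.
by move=> _ ->; rewrite vS.
Qed.

Lemma support_size_gt0 x mu : is_representation C d x mu -> (0 < support_size mu)%N.
Proof.
move=> /is_representationE[mu0 mu1 _]; rewrite -has_count.
apply: contraT => /hasPn H; move: (oner_neq0 R).
rewrite -mu1 big_seq big1 ?eqxx // => v vS; apply/eqP.
by rewrite eq_le mu0 // leNgt H.
Qed.

Lemma sum_fw_weights mu w gam (M : lmodType R) (F : 'cV[R]_p -> M) : V w ->
  \sum_(v <- S) fw_weights mu w gam v *: F v =
  (1 - gam) *: (\sum_(v <- S) mu v *: F v) + gam *: F w.
Proof.
move=> /mem_vertex_seq wS.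
rewrite -[gam *: F w](sum_pred1 (fun v => gam *: F v) vertex_seq_uniq wS).
rewrite scaler_sumr -big_split; apply: eq_bigr => v _ /=.
by rewrite /fw_weights scalerA mulrC; case: eqP => _; rewrite ?scalerDl // addr0.
Qed.

Lemma sum_away_weights mu u gam (M : lmodType R) (F : 'cV[R]_p -> M) : V u ->
  \sum_(v <- S) away_weights mu u gam v *: F v =
  (1 + gam) *: (\sum_(v <- S) mu v *: F v) - gam *: F u.
Proof.
move=> /mem_vertex_seq uS.
rewrite -[gam *: F u](sum_pred1 (fun v => gam *: F v) vertex_seq_uniq uS).
rewrite scaler_sumr -sumrB; apply: eq_bigr => v _ /=.
by rewrite /away_weights scalerA mulrC; case: eqP => _; rewrite ?scalerBl // subr0.
Qed.

(** Lets the module-valued sums of updated weights compute the total mass as well as the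
    barycentre. *)
Lemma sum_regular mu : \sum_(v <- S) mu v = \sum_(v <- S) mu v *: (1 : R^o).
Proof. by apply: eq_bigr => v _; rewrite /GRing.scale /= mulr1. Qed.

Lemma fw_weights_representation x mu w gam : V w -> 0 <= gam <= 1 ->
  is_representation C d x mu ->
  is_representation C d (x + gam *: (w - x)) (fw_weights mu w gam).
Proof.
move=> Vw /andP[g0 g1] /is_representationE[mu0 mu1 mux]; apply/is_representationE; split.
- move=> v vS; have := mulr_ge0 (mu0 v vS) (_ : 0 <= 1 - gam); rewrite subr_ge0 => /(_ g1) ?.
  by rewrite /fw_weights; case: eqP => // _; rewrite addr_ge0.
- rewrite sum_regular sum_fw_weights // -sum_regular mu1.
  by rewrite /GRing.scale /= !mulr1 subrK.
- by rewrite sum_fw_weights // mux; apply/matrixP => i j; rewrite !mxE; ring.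
Qed.

Lemma away_weights_representation x mu u gam : V u -> 0 <= gam ->
  gam * (1 - mu u) <= mu u -> is_representation C d x mu ->
  is_representation C d (x + gam *: (x - u)) (away_weights mu u gam).
Proof.
move=> Vu g0 gu /is_representationE[mu0 mu1 mux]; apply/is_representationE; split.
- move=> v vS; rewrite /away_weights; case: eqP => [->|_]; first by lra.
  by rewrite mulr_ge0 ?mu0 // addr_ge0.
- rewrite sum_regular sum_away_weights // -sum_regular mu1.
  by rewrite /GRing.scale /= !mulr1 addrK.
- by rewrite sum_away_weights // mux; apply/matrixP => i j; rewrite !mxE; ring.
Qed.

Lemma support_size_fw_weights mu w gam : V w -> 0 <= gam <= 1 ->
  (forall v, V v -> 0 <= mu v) ->
  (support_size (fw_weights mu w gam) <= (support_size mu).+1)%N.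
Proof.
move=> Vw /andP[g0 g1] mu0; rewrite /support_size -!size_filter.
apply: (@uniq_leq_size _ _ (w :: [seq v <- S | 0 < mu v])).
  by rewrite filter_uniq // vertex_seq_uniq.
move=> v; rewrite inE !mem_filter => /andP[+ vS]; rewrite vS andbT /fw_weights.
case: eqP => //= _; have := mu0 v (proj1 (mem_vertex_seq v) vS).
by rewrite le_eqVlt => /orP[/eqP <-|//]; rewrite mul0r ltxx.
Qed.

Lemma active_away_weights mu u gam : 0 <= gam -> active C d mu u ->
  active C d (away_weights mu u gam) `<=` active C d mu.
Proof.
move=> g0 [_ muu] v [Vv]; rewrite /away_weights; case: eqP => [vu _|_].
  by split; rewrite // vu.
by rewrite pmulr_lgt0 ?ltr_pwDl.
Qed.

Lemma support_size_drop mu nu u : active C d mu u -> nu u = 0 ->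
  active C d nu `<=` active C d mu ->
  (support_size nu < support_size mu)%N.
Proof.
move=> [/mem_vertex_seq uS muu] nuu nm; rewrite /support_size -!size_filter.
apply: (@uniq_leq_size _ (u :: [seq v <- S | 0 < nu v])).
  by rewrite /= mem_filter nuu ltxx filter_uniq // vertex_seq_uniq.
move=> v; rewrite inE !mem_filter => /orP[/eqP ->|/andP[nv vS]].
  by rewrite muu uS.
by have [] := nm v; [split=> //; apply/mem_vertex_seq | move=> _ ->].
Qed.

Lemma representation_update_support caratheodory x nu mu :
  is_representation C d x nu -> representation_update C d caratheodory x nu mu ->
  is_representation C d x mu /\ active C d mu `<=` active C d nu.
Proof.
move=> rnu; case: caratheodory => /= [[]//|munu]; split.
  have /is_representationE[nu0 nu1 nux] := rnu.
  have E v : v \in S -> mu v = nu v by move=> /mem_vertex_seq /munu.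
  apply/is_representationE; split=> [v vS||]; first by rewrite E // nu0.
    by rewrite -nu1; apply: eq_big_seq.
  by rewrite -nux; apply: eq_big_seq => v vS; rewrite E.
by move=> v [Vv]; rewrite munu.
Qed.

Lemma representation_update_rep_size caratheodory x nu mu :
  representation_update C d caratheodory x nu mu ->
  (support_size mu <= rep_size C d caratheodory)%N.
Proof.
case: caratheodory => /= [[_ _ cmu]|_]; first last.
  exact: count_size.
by rewrite support_size_active geq_card_fset_set.
Qed.

(** If [u] carried all the mass, [x] would equal [u] and the inequality would contradict the
    optimality of [w]. Hence the maximal away step is a genuine quotient. *)
Lemma away_weight_lt1 x mu g w u : is_representation C d x mu ->
  is_fw_vertex C d g w -> active C d mu u ->
  0 < dot g (w + u - 2 *: x) -> mu u < 1.
Proof.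
move=> rx [_ gw] [/mem_vertex_seq uS muu].
have Px := representation_polyhedron rx.
have /is_representationE[mu0 mu1 mux] := rx.
have mu1E : mu u + \sum_(v <- S | v != u) mu v = 1.
  by rewrite -mu1 [RHS](bigD1_seq u) //= vertex_seq_uniq.
have rest0 : 0 <= \sum_(v <- S | v != u) mu v.
  by rewrite big_seq_cond sumr_ge0 // => v /andP[vS _]; exact: mu0.
move=> H; rewrite lt_neqAle; apply/andP; split; last by lra.
apply: contraTneq H => muu1; rewrite -leNgt.
have rest : \sum_(v <- S | v != u) mu v = 0 by lra.
suff -> : x = u.
  rewrite scaler_nat mulr2n opprD addrACA subrr addr0 dotBr subr_le0.
  by apply: gw; have [] := proj1 (mem_vertex_seq u) uS.
rewrite -mux (bigD1_seq u) ?vertex_seq_uniq //= muu1 scale1r.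
rewrite big_seq_cond big1 ?addr0 // => v /andP[vS vu].
suff -> : mu v = 0 by rewrite scale0r.
apply/eqP; rewrite eq_le mu0 // andbT -rest (big_rem v) //= vu lerDl.
by rewrite big_seq_cond sumr_ge0 // => w' /andP[/mem_rem ? _]; exact: mu0.
Qed.

End Representations.

(** * One iteration *)

Section StepSize.
Context {R : realType} {p : nat} (G : 'cV[R]_p -> R) (s L : R) (x dir : 'cV[R]_p).
Hypothesis qG : quadratic_bounds s L G.
Hypotheses (s_ge0 : 0 <= s) (L_gt0 : 0 < L).

Let q := - dot (grad G x) dir.
Let e := enorm dir ^+ 2.

Lemma descent_along gam : G (x + gam *: dir) <= G x - gam * q + L / 2 * gam ^+ 2 * e.
Proof.
have [_] := qG x (x + gam *: dir).
have -> : x + gam *: dir - x = gam *: dir by rewrite addrC addKr.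
rewrite dotZr enormZ exprMn real_normK ?num_real // -/e /q; lra.
Qed.

Lemma descent_full_step : dir != 0 ->
  G (x + (q / (L * e)) *: dir) <= G x - q ^+ 2 / (2 * L * e).
Proof.
move=> /enorm_gt0 d0; have e0 : 0 < e by rewrite exprn_gt0.
apply: le_trans (descent_along _) _; rewrite le_eqVlt; apply/orP; left; apply/eqP.
by field; rewrite !lt0r_neq0.
Qed.

Lemma descent_truncated_step gam : 0 <= gam -> gam * (L * e) <= q ->
  G (x + gam *: dir) <= G x - gam * q / 2.
Proof.
move=> g0 gq; apply: le_trans (descent_along _) _.
have := ler_wpM2l g0 gq; rewrite expr2; lra.
Qed.

(* On a ray, a minimiser over [0, b] that is not the right end point stays a
   minimiser beyond b, by convexity. *)
Lemma line_search_beyond a b c : a < b <= c ->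
  G (x + a *: dir) <= G (x + b *: dir) -> G (x + a *: dir) <= G (x + c *: dir).
Proof.
move=> /andP[ab bc] Gab; set z := x + b *: dir.
have diffE t : x + t *: dir - z = (t - b) *: dir.
  by apply/matrixP => i j; rewrite !mxE; ring.
have lower t : G z + (t - b) * dot (grad G z) dir <= G (x + t *: dir).
  have [+ _] := qG z (x + t *: dir); rewrite diffE dotZr.
  by apply: le_trans; rewrite lerDl mulr_ge0 ?sqr_ge0 // divr_ge0.
have k0 : 0 <= dot (grad G z) dir.
  have := le_trans (lower a) Gab; rewrite gerDl -/z.
  by rewrite nmulr_rle0 // subr_lt0.
apply: le_trans Gab _; apply: le_trans (lower c).
by rewrite lerDl mulr_ge0 // subr_ge0.
Qed.

(** One interface for both step-size rules. Line search is at least as good as the trial steps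
    [q / (L * e)], which minimises the quadratic model, and [gmax]. The last conclusion serves away
    steps shorter than [gmax], those that need not drop a vertex. *)
Lemma asfw_step_size_le gmax gam : 0 <= q -> 0 <= gmax ->
  (dir = 0 -> q = 0) ->
  gam = short_step (grad G x) dir L gmax \/ is_line_search G x dir gmax gam ->
  [/\ 0 <= gam <= gmax,
      G (x + gam *: dir) <= G x,
      dir != 0 -> q <= gmax * (L * e) -> G (x + gam *: dir) <= G x - q ^+ 2 / (2 * L * e),
      q > gmax * (L * e) -> G (x + gam *: dir) <= G x - gmax * q / 2 &
      dir != 0 -> gam < gmax -> G (x + gam *: dir) <= G x - q ^+ 2 / (2 * L * e)].
Proof.
move=> q0 gm0 dq; rewrite /short_step -/q -/e.
have [d0|d0] := eqVneq dir 0.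
  move=> hgam; have Gx : G (x + gam *: dir) = G x by rewrite d0 scaler0 addr0.
  split=> //.
  - by case: hgam => [->|[]//]; rewrite lexx.
  - by rewrite Gx.
  - by rewrite Gx dq // mulr0 mul0r subr0.
have e0 : 0 < e by rewrite exprn_gt0 ?enorm_gt0.
have Le0 : 0 < L * e by rewrite mulr_gt0.
have full := descent_full_step d0.
have s0 : 0 <= q / (L * e) by rewrite divr_ge0 // ltW.
have trunc : gmax * (L * e) <= q -> G (x + gmax *: dir) <= G x - gmax * q / 2.
  exact: descent_truncated_step.
case=> [->|[gin ls]]; last first.
  split=> //.
  - by have := ls 0; rewrite lexx gm0 scale0r addr0; exact.
  - move=> _ qle; apply: le_trans (ls (q / (L * e)) _) full.
    by rewrite s0 ler_pdivrMr.
  - by move=> /ltW /trunc; apply: le_trans; apply: ls; rewrite gm0 lexx.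
  - move=> _ gamlt; apply: le_trans full.
    have [le|lt] := leP (q / (L * e)) gmax; first by apply: ls; rewrite s0.
    (* The model minimiser lies beyond [gmax], yet a line search stopping short of [gmax] still
       beats it. *)
    by apply: (@line_search_beyond _ gmax); [rewrite gamlt ltW | apply: ls; rewrite gm0 lexx].
have [le|lt] := leP (q / (L * e)) gmax.
  split=> //; first by rewrite s0.
  - by apply: le_trans full _; rewrite gerBl divr_ge0 ?sqr_ge0 // -mulrA mulr_ge0 // ltW.
  - by rewrite ltNge -ler_pdivrMr // le.
have lt' := lt; rewrite ltr_pdivlMr // in lt'.
split=> //.
- by rewrite gm0 lexx.
- by apply: le_trans (trunc (ltW lt')) _; rewrite gerBl divr_ge0 // mulr_ge0.
- by rewrite leNgt lt'.
- by move=> /ltW /trunc.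
- by rewrite ltxx.
Qed.

End StepSize.

Section Step.
Context {R : realType} {m p : nat} (C : 'M[R]_(m, p)) (d : 'cV[R]_m).
Variables (G : 'cV[R]_p -> R) (s L : R) (caratheodory : bool).
Implicit Types (x y z v w g u : 'cV[R]_p) (mu nu : 'cV[R]_p -> R).
Hypothesis qG : quadratic_bounds s L G.
Hypotheses (s_gt0 : 0 < s) (L_gt0 : 0 < L).

Let P := polyhedron C d.
Let V := vertices C d.
Let D := diameter C d.
Let S := vertex_seq C d.
Hypothesis P_compact : compact P.

(** Here [M] is the pairwise gap from [u] to [w], split into away gap and Frank-Wolfe gap because
    each is bounded by the slope of the chosen direction. *)
Lemma away_gap_lower x mu w u (N : nat) y : is_representation C d x mu ->
  is_fw_vertex C d (grad G x) w -> is_away_vertex C d (grad G x) mu u ->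
  (support_size C d mu <= N)%N -> P y ->
  Omega C d * dot (grad G x) (x - y) <=
    N%:R * enorm (x - y) * (dot (grad G x) (u - x) + dot (grad G x) (x - w)).
Proof.
move=> rx [Vw gw] [[Vu mu_u] gu] sN Py.
have /is_representationE[mu0 mu1 mux] := rx.
have uwE : dot (grad G x) (u - x) + dot (grad G x) (x - w) = dot (grad G x) (u - w).
  by rewrite -dotDr addrA subrK.
rewrite uwE.
have uw0 : 0 <= dot (grad G x) (u - w).
  by rewrite dotBr subr_ge0; apply: gw; case: Vu.
apply: le_trans (_ : (support_size C d mu)%:R * enorm (x - y) * dot (grad G x) (u - w) <= _).
  apply: (@away_gap_bound _ _ _ C d S mu) => //.
  - exact: vertex_seq_uniq.
  - by move=> v /mem_vertex_seq.
  - move=> v z /mem_vertex_seq Vv mv Pz; rewrite !dotBr lerB ?gw //.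
    by apply: gu.
by rewrite -!mulrA ler_wpM2r ?mulr_ge0 ?enorm_ge0 // ler_nat.
Qed.

(** The squared form carries the factor [enorm (x - y) ^+ 2], which cancels against the same factor
    in the transport bound. *)
Lemma strong_convexity_gap x y (a := G x - G y) : 0 <= a ->
  2 * s * a * enorm (x - y) ^+ 2 <= dot (grad G x) (x - y) ^+ 2 /\
  a <= dot (grad G x) (x - y).
Proof.
move=> a0; have [H _] := qG x y.
have {}H : a + s / 2 * enorm (x - y) ^+ 2 <= dot (grad G x) (x - y).
  by move: H; rewrite /a enormB !dotBr; lra.
have r0 : 0 <= s / 2 * enorm (x - y) ^+ 2 by rewrite mulr_ge0 ?sqr_ge0 // divr_ge0 // ltW.
split; last by lra.
(* AM-GM: [4 a b <= (a + b)^2] with [b = s r^2 / 2] *)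
apply: le_trans (_ : (a + s / 2 * enorm (x - y) ^+ 2) ^+ 2 <= _); last first.
  by rewrite ler_sqr // ?nnegrE; lra.
rewrite -subr_ge0.
have -> : (a + s / 2 * enorm (x - y) ^+ 2) ^+ 2 - 2 * s * a * enorm (x - y) ^+ 2 =
  (a - s / 2 * enorm (x - y) ^+ 2) ^+ 2 by field.
exact: sqr_ge0.
Qed.

(** Squaring [away_gap_lower] and inserting [strong_convexity_gap], the distance to [y] cancels. The
    result says that the decrease of a full step, [q ^+ 2 / (2 * L * D ^+ 2)], is at least [c] times
    the gap. *)
Lemma contraction_key x mu w u (N : nat) (c : R) q y :
  is_representation C d x mu ->
  is_fw_vertex C d (grad G x) w -> is_away_vertex C d (grad G x) mu u ->
  (support_size C d mu <= N)%N -> P y ->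
  0 <= c -> c * (4 * N%:R ^+ 2 * L * D ^+ 2) <= Omega C d ^+ 2 * s -> (0 < N)%N ->
  dot (grad G x) (x - w) <= q -> dot (grad G x) (u - x) <= q ->
  c * (G x - G y) * (2 * L * D ^+ 2) <= q ^+ 2.
Proof.
move=> rx fw aw sN Py c0 cN N0 q1 q2.
have [a0|a0] := leP (G x - G y) 0.
  apply: le_trans (_ : 0 <= _); last exact: sqr_ge0.
  rewrite mulr_le0_ge0 ?mulr_ge0_le0 // mulr_ge0 ?sqr_ge0 // mulr_ge0 // ltW //.
set a := G x - G y in a0 *.
have [k1 k2] := strong_convexity_gap (ltW a0).
rewrite -/a in k1 k2.
have Om0 := Omega_ge0 C d.
have r0 : 0 < enorm (x - y).
  by apply: enorm_gt0; rewrite subr_eq0; apply: contraTneq a0 => xy; rewrite /a xy subrr ltxx.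
have q0 : 0 <= q.
  apply: le_trans q1; rewrite dotBr subr_ge0; case: fw => _; apply.
  exact: representation_polyhedron rx.
have Nr0 : 0 < N%:R :> R by rewrite ltr0n.
have k3 : Omega C d * dot (grad G x) (x - y) <= N%:R * enorm (x - y) * (2 * q).
  apply: le_trans (away_gap_lower rx fw aw sN Py) _.
  by rewrite ler_wpM2l ?mulr_ge0 ?enorm_ge0 //; lra.
have k4 : (Omega C d * dot (grad G x) (x - y)) ^+ 2 <= (N%:R * enorm (x - y) * (2 * q)) ^+ 2.
  have s0 := le_trans (ltW a0) k2.
  have h1 := mulr_ge0 Om0 s0; have h2 := le_trans h1 k3.
  by rewrite ler_sqr.
have k5 : Omega C d ^+ 2 * (2 * s * a * enorm (x - y) ^+ 2) <=
    (N%:R * enorm (x - y) * (2 * q)) ^+ 2.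
  by apply: le_trans k4; rewrite [leRHS]exprMn; apply: ler_wpM2l k1; exact: sqr_ge0.
have k6 : Omega C d ^+ 2 * s * a <= 2 * N%:R ^+ 2 * q ^+ 2.
  rewrite -(@ler_pM2r _ (2 * enorm (x - y) ^+ 2)) ?mulr_gt0 ?exprn_gt0 //.
  by apply: le_trans (_ : _ <= (N%:R * enorm (x - y) * (2 * q)) ^+ 2) _;
     [apply: le_trans k5 | ]; rewrite le_eqVlt; apply/orP; left; apply/eqP; ring.
have k7 := ler_wpM2r (ltW a0) cN.
rewrite -(@ler_pM2r _ (2 * N%:R ^+ 2)) ?mulr_gt0 ?exprn_gt0 //.
rewrite [leRHS]mulrC; apply: le_trans k6; apply: le_trans k7.
by rewrite le_eqVlt; apply/orP; left; apply/eqP; ring.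
Qed.

(* The first alternative is a drop step; the others contract the optimality gap
   but may enlarge the support of the representation. *)
Lemma asfw_step_progress x mu x' mu' (c : R) (N := rep_size C d caratheodory) :
  is_representation C d x mu -> asfw_step C d caratheodory G L x mu x' mu' ->
  (support_size C d mu <= N)%N ->
  0 <= c <= 1 / 2 -> c * (4 * N%:R ^+ 2 * L * D ^+ 2) <= Omega C d ^+ 2 * s ->
  [/\ is_representation C d x' mu', (support_size C d mu' <= N)%N &
   ((support_size C d mu' < support_size C d mu)%N /\ G x' <= G x) \/
   ((support_size C d mu' <= (support_size C d mu).+1)%N /\
    forall y, P y -> G x' <= G x - c * (G x - G y))].
Proof.
move=> rx [w [u [gam /=]]]; set g := grad G x.
set fw := dot g _ <= 0; set dir := if fw then _ else _.
set gmax := if fw then _ else _; set nu := if fw then _ else _.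
move=> [fwv awv hgam -> upd] sN /andP[c0 c2] cN.
have Px := representation_polyhedron rx.
have [mu0 _ _] := rx.
have [Vw gw] := fwv; have [[Vu muu] gu] := awv.
have Pw : P w by case: Vw. have Pu : P u by case: Vu.
have N0 : (0 < N)%N by apply: leq_trans sN; exact: support_size_gt0 rx.
pose q := - dot g dir.
have A0 : 0 <= dot g (x - w) by rewrite dotBr subr_ge0 gw.
(* The test compares the two gaps, so [q] is the larger of them. *)
have fwE : fw = (dot g (u - x) <= dot g (x - w)).
  rewrite /fw -subr_ge0 -[RHS]subr_ge0 sub0r; congr (0 <= _).
  by rewrite !dotBr dotDr dotZr; ring.
have [q1 q2] : dot g (x - w) <= q /\ dot g (u - x) <= q.
  rewrite /q -dotNr /dir; case: ifPn; rewrite fwE opprB //.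
  by rewrite -ltNge => /ltW.
have q0 : 0 <= q by apply: le_trans q1.
have PD a b : P a -> P b -> enorm (a - b) ^+ 2 <= D ^+ 2.
  move=> Pa Pb; have ab := enorm_le_diameter P_compact Pa Pb.
  by rewrite ler_sqr // nnegrE ?enorm_ge0 // (le_trans _ ab) // enorm_ge0.
have dirD : enorm dir ^+ 2 <= D ^+ 2 by rewrite /dir; case: ifPn => _; exact: PD.
have muu1 : ~~ fw -> mu u < 1.
  by rewrite /fw -ltNge; apply: away_weight_lt1 rx fwv _; split.
have gm0 : 0 <= gmax.
  rewrite /gmax; case: ifPn => // /muu1 ?.
  by rewrite divr_ge0 ?subr_ge0 ?mu0 // ltW.
have dq : dir = 0 -> q = 0 by rewrite /q => ->; rewrite dot0r oppr0.
have [gin Gle full1 full2 full3] := asfw_step_size_le qG (ltW s_gt0) L_gt0 q0 gm0 dq hgam.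
rewrite -/q in full1 full2 full3.
have key y : P y -> c * (G x - G y) * (2 * L * D ^+ 2) <= q ^+ 2.
  by move=> Py; exact: (contraction_key rx fwv awv sN Py c0 cN N0 q1 q2).
have good_full y : P y -> dir != 0 -> c * (G x - G y) <= q ^+ 2 / (2 * L * enorm dir ^+ 2).
  move=> Py /enorm_gt0 d0.
  have Le0 : 0 < 2 * L * enorm dir ^+ 2 by rewrite !mulr_gt0 ?exprn_gt0.
  rewrite ler_pdivlMr //; have [a0|a0] := leP (G x - G y) 0.
    by apply: le_trans (sqr_ge0 q); rewrite mulr_le0_ge0 ?mulr_ge0_le0 // ltW.
  apply: le_trans (key y Py); rewrite ler_wpM2l ?mulr_ge0 // ?(ltW a0) //.
  by rewrite ler_wpM2l // mulr_ge0 // ltW.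
(* Covers a Frank-Wolfe step cut at length 1: it gains [q / 2], while the gap is at most [q] by
   convexity and [c] is at most one half. *)
have good_half y : P y -> c * (G x - G y) <= q / 2.
  move=> Py; have [a0|a0] := leP (G x - G y) 0.
    by apply: le_trans (_ : 0 <= _); [rewrite mulr_ge0_le0 | rewrite divr_ge0].
  have [_ k] := strong_convexity_gap (ltW a0).
  have {}k : G x - G y <= q.
    apply: le_trans k _; apply: le_trans q1; rewrite -/g !dotBr lerB // gw //.
  by have := ler_wpM2r (ltW a0) c2; lra.
have d_neq0 : ~~ fw -> dir != 0.
  move=> nfw; have : 0 < q.
    by apply: lt_le_trans q2; apply: le_lt_trans A0 _; move: nfw; rewrite fwE -ltNge.
  by apply: contraTneq => /dq ->; rewrite ltxx.
have good y : fw \/ gam < gmax -> P y -> G (x + gam *: dir) <= G x - c * (G x - G y).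
  move=> hfw Py; have [d0|d0] := eqVneq dir 0.
    have E : x + gam *: dir = x by rewrite d0 scaler0 addr0.
    rewrite E lerBrDr gerDl; apply: le_trans (good_half y Py) _.
    by rewrite dq // mul0r.
  have Gf := good_full y Py d0.
  have [gamlt|gamge] := ltP gam gmax.
    by apply: le_trans (full3 d0 gamlt) _; rewrite lerB.
  case: hfw => [hfw|]; last by rewrite ltNge gamge.
  have [le|lt] := leP q (gmax * (L * enorm dir ^+ 2)).
    by apply: le_trans (full1 d0 le) _; rewrite lerB.
  apply: le_trans (full2 lt) _; rewrite lerB //.
  by rewrite /gmax hfw mul1r; exact: good_half.
have rnu : is_representation C d (x + gam *: dir) nu.
  rewrite /nu /dir; move: gin; rewrite /gmax; case: ifPn => [_|nfw] gin.
    exact: fw_weights_representation.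
  have /andP[g0 g1] := gin; apply: away_weights_representation => //.
  by move: g1; rewrite ler_pdivlMr // subr_gt0 muu1.
have [rmu sub] := representation_update_support rnu upd.
have sizeN := representation_update_rep_size upd.
split=> //.
have g0 : 0 <= gam by case/andP: gin.
have [hfw|nfw] := boolP fw.
  right; split; last by move=> y; apply: good; left.
  apply: leq_trans (sub_support sub) _; rewrite /nu hfw.
  by apply: support_size_fw_weights => //; move: gin; rewrite /gmax hfw.
have nuE : nu = away_weights mu u gam by rewrite /nu (negbTE nfw).
have subnu : active C d nu `<=` active C d mu by rewrite nuE; exact: active_away_weights.
have [gamlt|gamge] := ltP gam gmax.
  right; split; last by move=> y; apply: good; right.
  by apply: leqW; apply: sub_support => v /sub /subnu.
(* An away step of maximal length remains; it annihilates the weight of [u]. *)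
left; split=> //.
have gamE : gam = mu u / (1 - mu u).
  by apply/eqP; move: gin gamge; rewrite /gmax (negbTE nfw) => /andP[_ g1] g2; rewrite eq_le g1.
have nuu : nu u = 0.
  rewrite nuE /away_weights eqxx gamE; field.
  by rewrite lt0r_neq0 // subr_gt0 muu1.
apply: leq_ltn_trans (sub_support sub) _.
exact: (support_size_drop (u := u)).
Qed.

End Step.

(** * The run, sample path by sample path *)

Section ConstantBounds.
Context {R : realType} {n : nat} (sigma L : 'I_n -> R).

Lemma sigmaF_le i : (forall j, 0 < sigma j) -> sigmaF sigma <= sigma i.
Proof.
move=> s0; apply: ge_inf; last by exists i.
by exists 0 => _ [j _ <-]; exact: ltW.
Qed.

Lemma sigmaF_gt0 : (0 < n)%N -> (forall j, 0 < sigma j) -> 0 < sigmaF sigma.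
Proof.
move=> n0 s0; have [e e0 He] := positive_lower_bound [seq sigma j | j <- enum 'I_n].
apply: lt_le_trans e0 _; apply: lb_le_inf; first by exists (sigma (Ordinal n0)), (Ordinal n0).
by move=> _ [j _ <-]; apply: He => //; apply: map_f; rewrite mem_enum.
Qed.

Lemma le_LF i : L i <= LF L.
Proof.
apply: ub_le_sup; last by exists i.
exists (\sum_j `|L j|) => _ [j _ <-]; rewrite (bigD1 j) //=.
by rewrite (le_trans (ler_norm _)) // lerDl sumr_ge0.
Qed.

Lemma mean_bounds (N : nat) (F : 'I_N -> R) a b : (0 < N)%N ->
  (forall i, a <= F i <= b) -> a <= N%:R^-1 * \sum_i F i <= b.
Proof.
move=> N0 Fab; have N0' : 0 < N%:R :> R by rewrite ltr0n.
have E (c : R) : c * N%:R = \sum_(i < N) c by rewrite sumr_const card_ord mulr_natr.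
rewrite mulrC ler_pdivlMr // ler_pdivrMr // !E.
by apply/andP; split; apply: ler_sum => i _; have /andP[] := Fab i.
Qed.

End ConstantBounds.

Section RhoBounds.
Context {R : realType} {m p n : nat} (C : 'M[R]_(m, p)) (d : 'cV[R]_m).
Variables (sigma L : 'I_n -> R) (caratheodory : bool).
Hypothesis n_gt0 : (0 < n)%N.
Hypotheses (sigma_gt0 : forall i, 0 < sigma i) (sigma_le_L : forall i, sigma i <= L i).
Hypothesis P_compact : compact (polyhedron C d).
Variable v : 'cV[R]_p.
Hypothesis Vv : vertices C d v.
Hypothesis D_neq0 : diameter C d != 0.

Let r := rho C d sigma L caratheodory.
Let N := rep_size C d caratheodory.
Let D := diameter C d.

Lemma diameter_ge0 : 0 <= D.
Proof.
have Pv : polyhedron C d v by case: Vv.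
by have := enorm_le_diameter P_compact Pv Pv; rewrite subrr enorm0.
Qed.

Lemma rep_size_gt0 : (0 < N)%N.
Proof.
rewrite /N /rep_size; case: caratheodory => //.
by rewrite cardfs_gt0; apply/fset0Pn; exists v; apply/mem_vertex_seq.
Qed.

(** The second term of the minimum is at most 1/16, since [Omega] is at most the diameter, [sigmaF]
    at most [LF], and the representation size at least 1. *)
Lemma rho_bounds :
  [/\ 0 < r, r <= 1 / 16 &
      r * (16 * N%:R ^+ 2 * LF L * D ^+ 2) <= Omega C d ^+ 2 * sigmaF sigma].
Proof.
have D0 : 0 < D by rewrite lt_neqAle eq_sym D_neq0 diameter_ge0.
have s0 := sigmaF_gt0 n_gt0 sigma_gt0.
have sL : sigmaF sigma <= LF L.
  pose i := Ordinal n_gt0; apply: le_trans (le_LF L i).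
  by apply: le_trans (sigma_le_L i); exact: sigmaF_le.
have L0 := lt_le_trans s0 sL.
have N1 : 1 <= N%:R :> R by rewrite ler1n rep_size_gt0.
have N0 : 0 < N%:R :> R by rewrite ltr0n rep_size_gt0.
have Om0 := Omega_gt0 P_compact Vv D_neq0.
have OmD := Omega_le_diameter P_compact Vv D_neq0.
set X := 16 * N%:R ^+ 2 * LF L * D ^+ 2.
have X0 : 0 < X by rewrite !mulr_gt0 ?exprn_gt0.
have rE : r = Num.min 2^-1 (Omega C d ^+ 2 * sigmaF sigma / X).
  by rewrite /r /rho (negbTE D_neq0).
have rX : r <= Omega C d ^+ 2 * sigmaF sigma / X by rewrite rE ge_min lexx orbT.
split; last by rewrite -ler_pdivlMr.
  by rewrite rE lt_min invr_gt0 ltr0n divr_gt0 // mulr_gt0 // exprn_gt0.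
apply: le_trans rX _; rewrite ler_pdivrMr //.
have -> : 1 / 16 * X = D ^+ 2 * LF L * N%:R ^+ 2 by rewrite /X; field.
apply: le_trans (_ : D ^+ 2 * LF L <= _).
  apply: ler_pM => //; [exact: sqr_ge0 | exact: ltW |].
  by apply: lerXn2r; rewrite // nnegrE ltW.
by rewrite ler_peMr ?exprn_ege1 // mulr_ge0 ?sqr_ge0 // (ltW L0).
Qed.

End RhoBounds.

Section Sampling.
Context {R : realType} {p n : nat} (f : 'I_n -> 'cV[R]_p -> R).

(** The l1 distance between the empirical distribution of the batch and the uniform one. *)
Definition sampling_error (N : nat) (s : 'I_N -> 'I_n) : R :=
  \sum_l `|N%:R^-1 * \sum_i (s i == l)%:R - n%:R^-1|.

Lemma sampling_error_ge0 N (s : 'I_N -> 'I_n) : 0 <= sampling_error s.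
Proof. exact: sumr_ge0. Qed.

(** Grouping the batch by sampled index makes the difference a combination of the values [f l x]
    with the frequency deviations as coefficients. The bound is uniform in [x], so it also holds at
    iterates that depend on the batch. *)
Lemma batch_objective_error N (s : 'I_N -> 'I_n) x B : (0 < N)%N ->
  (forall i, `|f i x| <= B) ->
  `|batch_objective f s x - objective f x| <= B * sampling_error s.
Proof.
move=> N0 fB.
have -> : batch_objective f s x - objective f x =
    \sum_l (N%:R^-1 * \sum_i (s i == l)%:R - n%:R^-1) * f l x.
  rewrite /batch_objective /objective; under [RHS]eq_bigr do rewrite mulrBl.
  rewrite sumrB -mulr_sumr; congr (_ - _).
  under [RHS]eq_bigr do rewrite -mulrA mulr_suml.
  rewrite -mulr_sumr exchange_big /=; congr (_ * _); apply: eq_bigr => i _.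
  rewrite (bigD1 (s i)) //= eqxx mul1r big1 ?addr0 // => l.
  by rewrite eq_sym => /negbTE ->; rewrite mul0r.
apply: le_trans (ler_norm_sum _ _ _) _; rewrite mulr_sumr; apply: ler_sum => l _.
by rewrite normrM mulrC ler_wpM2r.
Qed.

End Sampling.

(** * Propagating the gap along a sample path *)

Section Trajectory.
Context {R : realType} {m p n : nat} (C : 'M[R]_(m, p)) (d : 'cV[R]_m).
Variables (f : 'I_n -> 'cV[R]_p -> R) (sigma L : 'I_n -> R) (caratheodory : bool).
Hypothesis n_gt0 : (0 < n)%N.
Hypothesis f_convex : forall i, strongly_convex (sigma i) (f i).
Hypothesis f_smooth : forall i, lipschitz_gradient (L i) (f i).
Hypothesis P_compact : compact (polyhedron C d).

Let P := polyhedron C d.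
Let V := vertices C d.
Let D := diameter C d.
Let N := rep_size C d caratheodory.
Let F := objective f.
Let Fmin := optimum f P.

Variable B : R.
Hypothesis f_bounded : forall i x, P x -> `|f i x| <= B.

Lemma objective_bounded x : P x -> `|F x| <= B.
Proof.
move=> Px; rewrite ler_norml; apply: mean_bounds => // i.
by rewrite -ler_norml f_bounded.
Qed.

Lemma optimum_le x : P x -> Fmin <= F x.
Proof.
move=> Px; apply: ge_inf; last by exists x.
by exists (- B) => _ [y Py <-]; have := objective_bounded Py; rewrite ler_norml => /andP[].
Qed.

Lemma le_optimum a : P !=set0 -> (forall y, P y -> a <= F y) -> a <= Fmin.
Proof.
move=> [y Py] H; apply: lb_le_inf; first by exists (F y), y.
by move=> _ [z Pz <-]; exact: H.
Qed.

Variable c : R.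
Hypothesis c_bounds : 0 < c <= 1 / 2.
Hypothesis c_le : c * (4 * N%:R ^+ 2 * LF L * D ^+ 2) <= Omega C d ^+ 2 * sigmaF sigma.

(** Passing from the sampled objective to [F] costs one error at [x'] and, with weights [1 - c] and
    [c], one at [x] and at the comparison point; hence the factor 2. *)
Lemma asfw_gap_progress (b : nat) (s : 'I_b -> 'I_n) x mu x' mu' :
  (0 < b)%N -> (exists v : 'cV[R]_p, v != 0) ->
  is_representation C d x mu ->
  asfw_step C d caratheodory (batch_objective f s) (batch_lipschitz L s) x mu x' mu' ->
  (support_size C d mu <= N)%N ->
  [/\ is_representation C d x' mu', (support_size C d mu' <= N)%N &
   ((support_size C d mu' < support_size C d mu)%N /\
     F x' - Fmin <= F x - Fmin + 2 * (B * sampling_error s)) \/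
   ((support_size C d mu' <= (support_size C d mu).+1)%N /\
     F x' - Fmin <= (1 - c) * (F x - Fmin) + 2 * (B * sampling_error s))].
Proof.
move=> b0 [v0 v0_neq0] rx step sN.
have /andP[c0 c2] := c_bounds.
have s0 i : 0 < sigma i by case: (f_convex i).
have sL i : sigma i <= L i := strongly_convex_le_smooth v0_neq0 (f_smooth i) (f_convex i).
have sF0 := sigmaF_gt0 n_gt0 s0.
have Lk : sigmaF sigma <= batch_lipschitz L s <= LF L.
  apply: mean_bounds => // i; rewrite le_LF andbT.
  by apply: le_trans (sL _); exact: sigmaF_le.
have /andP[Lk0 LkF] := Lk.
have qf i : quadratic_bounds (sigmaF sigma) (L i) (f i).
  move=> y z; split; last exact: smooth_upper.
  apply: le_trans (strongly_convex_lower y z (f_smooth i) (f_convex i)).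
  by rewrite lerD2l ler_wpM2r ?sqr_ge0 // ler_pM2r // sigmaF_le.
have qG := batch_quadratic_bounds s b0 f_smooth qf.
have cN : c * (4 * N%:R ^+ 2 * batch_lipschitz L s * D ^+ 2) <= Omega C d ^+ 2 * sigmaF sigma.
  apply: le_trans c_le; rewrite ler_wpM2l ?(ltW c0) // ler_wpM2r ?sqr_ge0 //.
  by rewrite ler_wpM2l // mulr_ge0 ?sqr_ge0.
have c01 : 0 <= c <= 1 / 2 by rewrite ltW.
have [rx' sN' alt] := asfw_step_progress qG sF0 (lt_le_trans sF0 Lk0) P_compact
  rx step sN c01 cN.
split=> //.
have Px := representation_polyhedron rx; have Px' := representation_polyhedron rx'.
have P0 : P !=set0 by exists x.
have err y : P y -> `|batch_objective f s y - F y| <= B * sampling_error s.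
  by move=> Py; apply: batch_objective_error => // i; exact: f_bounded.
have := err x Px; have := err x' Px'; rewrite !ler_norml => /andP[e1 e2] /andP[e3 e4].
case: alt => -[su Gle]; [left | right]; split=> //; first by lra.
(* Solved for [F y], the inequality passes to the infimum over [y]. *)
have H : ((F x' - (1 - c) * F x - 2 * (B * sampling_error s)) / c) <= Fmin.
  apply: le_optimum => // y Py; rewrite ler_pdivrMr //.
  have := Gle y Py; have := err y Py; rewrite ler_norml => /andP[e5 e6].
  nra.
by rewrite ler_pdivrMr // in H; lra.
Qed.

Variables (x : nat -> 'cV[R]_p) (mu : nat -> 'cV[R]_p -> R).
Variables (b : nat -> nat) (s : forall k, 'I_(b k) -> 'I_n).
Hypothesis b_gt0 : forall k, (1 <= k)%N -> (0 < b k)%N.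
Hypothesis dim_gt0 : exists v : 'cV[R]_p, v != 0.
Hypothesis x1_vertex : V (x 1%N).
Hypothesis mu1E : forall v, V v -> mu 1%N v = (v == x 1%N)%:R.
Hypothesis steps : forall k, (1 <= k)%N ->
  asfw_step C d caratheodory (batch_objective f (@s k)) (batch_lipschitz L (@s k))
    (x k) (mu k) (x k.+1) (mu k.+1).

Variable q : R.
Hypothesis q_gt0 : 0 < q.
Hypothesis q_sqr : q ^+ 2 = 1 - c.

Lemma start_representation :
  is_representation C d (x 1%N) (mu 1%N) /\ (support_size C d (mu 1%N) <= N)%N.
Proof.
have S1 := x1_vertex; move/mem_vertex_seq in S1.
have E v : v \in vertex_seq C d -> mu 1%N v = if v == x 1%N then 1 else 0.
  by move=> /mem_vertex_seq Vv; rewrite mu1E //; case: eqP.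
split.
  apply/is_representationE; split.
  - by move=> v vS; rewrite E //; case: ifP.
  - rewrite -[RHS](sum_pred1 (fun=> 1) (vertex_seq_uniq C d) S1).
    exact: eq_big_seq.
  - rewrite -[RHS](sum_pred1 id (vertex_seq_uniq C d) S1); apply: eq_big_seq => v vS.
    by rewrite E //; case: ifP; rewrite ?scale1r ?scale0r.
rewrite /support_size (@eq_in_count _ _ (pred1 (x 1%N))) => [|v vS]; last first.
  by rewrite E //=; case: eqP; rewrite ?ltr01 ?ltxx.
rewrite count_uniq_mem ?vertex_seq_uniq // S1 /N /rep_size; case: caratheodory => //.
by rewrite cardfs_gt0; apply/fset0Pn; exists (x 1%N).
Qed.

(* Weighting the gap by [q^-1] to the size of the support makes every step,
   drop or not, a contraction by the factor [q]. *)
Lemma asfw_gap_bound k (K := 2 * B * q^-1 ^+ N) :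
  0 <= F (x k.+1) - Fmin <=
    K * (q ^+ k + \sum_(1 <= j < k.+1) q ^+ (k - j) * sampling_error (@s j)).
Proof.
have /andP[c0 c2] := c_bounds.
have q1 : q < 1.
  rewrite ltNge; apply/negP => q1; have := exprn_ege1 2 q1; rewrite q_sqr; lra.
have qV1 : 1 <= q^-1 by rewrite invf_ge1 // ltW.
have qV0 : 0 < q^-1 by rewrite invr_gt0.
pose u k := support_size C d (mu k).
pose h k := F (x k) - Fmin.
(* The solution of the recursion [E k.+1 = q * E k + K * e]; the initial gap is at most [2 * B] and
   every weight at most [q^-1 ^+ N], whence [K]. *)
pose E k := K * (q ^+ k + \sum_(1 <= j < k.+1) q ^+ (k - j) * sampling_error (@s j)).
suff [rx uN hE] : [/\ is_representation C d (x k.+1) (mu k.+1), (u k.+1 <= N)%N &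
    h k.+1 * q^-1 ^+ u k.+1 <= E k].
  have h0 : 0 <= h k.+1.
    by rewrite subr_ge0; exact/optimum_le/representation_polyhedron/rx.
  rewrite h0 /=; apply: le_trans hE.
  by rewrite ler_peMr ?exprn_ege1.
have B0 : 0 <= B.
  have [Px1 _] := x1_vertex.
  exact: le_trans (normr_ge0 _) (f_bounded (Ordinal n_gt0) Px1).
have P0 : P !=set0 by exists (x 1%N); case: x1_vertex.
have expN j : (j <= N)%N -> q^-1 ^+ j <= q^-1 ^+ N.
  by move=> jN; exact: ler_weXn2l.
elim: k => [|k [rx uN hE]].
  have [rx uN] := start_representation; split=> //.
  have Px := representation_polyhedron rx.
  have h0 : 0 <= h 1%N by rewrite subr_ge0 optimum_le.
  rewrite /E big_geq // expr0 addr0 mulr1; apply: ler_pM => //.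
  - by rewrite exprn_ge0 // ltW.
  - have := objective_bounded Px; rewrite ler_norml /h => /andP[_ F1].
    have : - B <= Fmin.
      by apply: le_optimum => // y /objective_bounded; rewrite ler_norml => /andP[].
    lra.
  - exact: expN.
have Px := representation_polyhedron rx.
have h0 : 0 <= h k.+1 by rewrite subr_ge0 optimum_le.
have [rx' uN' alt] := asfw_gap_progress (b_gt0 (ltn0Sn k)) dim_gt0 rx (steps (ltn0Sn k)) uN.
split=> //.
set e := sampling_error _ in alt.
have e0 : 0 <= 2 * (B * e) by rewrite !mulr_ge0 // sampling_error_ge0.
have EE : E k.+1 = q * E k + K * e.
  rewrite /E big_nat_recr //= subnn expr0 mul1r exprS -/e.
  rewrite !mulrDr !mulr_sumr addrA; congr (_ + _); congr (_ + _); first by ring.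
  apply: eq_big_nat => j /andP[_ jk]; rewrite subSn // exprS; ring.
have KE : 2 * (B * e) * q^-1 ^+ u k.+2 <= K * e.
  have -> : K * e = 2 * (B * e) * q^-1 ^+ N by rewrite /K; move: (q^-1 ^+ N) => Q; ring.
  by rewrite ler_wpM2l // expN.
rewrite EE; apply: le_trans (lerD (ler_wpM2l (ltW q_gt0) hE) KE).
case: alt => -[su Hle]; rewrite -/(h k.+2) -/(h k.+1) in Hle;
  apply: le_trans (ler_wpM2r (exprn_ge0 _ (ltW qV0)) Hle) _; rewrite mulrDl lerD2r.
(* Drop step: the gap grows only by the noise, and the weight shrinks by at least one factor [q]. *)
- apply: le_trans (_ : h k.+1 * q^-1 ^+ (u k.+1).-1 <= _).
    by rewrite ler_wpM2l // ler_weXn2l // -ltnS prednK // (leq_trans _ su).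
  have -> : u k.+1 = (u k.+1).-1.+1 by rewrite prednK // (leq_trans _ su).
  by rewrite exprS [_.+1.-1]/=  mulrCA mulVKf ?lt0r_neq0.
(* Other step: the gap gains two factors [q], and the weight gives back at most one. *)
- rewrite -q_sqr; apply: le_trans (_ : q ^+ 2 * h k.+1 * q^-1 ^+ (u k.+1).+1 <= _).
    apply: ler_wpM2l; first exact: mulr_ge0 (sqr_ge0 _) h0.
    exact: ler_weXn2l.
  rewrite [q^-1 ^+ _]exprS expr2 le_eqVlt; apply/orP; left; apply/eqP.
  by rewrite -!mulrA; congr (_ * _); rewrite mulrCA mulVKf ?lt0r_neq0.
Qed.

End Trajectory.

(** * The sampling error in mean *)

Section Means.
Context {dT : measure_display} {T : measurableType dT} {R : realType}.
Variable Pr : probability T R.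
Implicit Types (X Y : T -> R) (e a : R).

(* The integral of a nonnegative function is a supremum over the simple
   functions below it, so monotonicity requires no measurability. *)
Lemma le_expectation X Y : (forall t, 0 <= X t) -> (forall t, X t <= Y t) ->
  ('E_Pr[X] <= 'E_Pr[Y])%E.
Proof.
move=> X0 XY; rewrite unlock !ge0_integralTE => [|t|t].
- apply: le_ereal_sup => _ [h hX <-]; exists h => // t.
  by apply: le_trans (hX t) _; rewrite lee_fin.
- by rewrite lee_fin (le_trans (X0 t)).
- by rewrite lee_fin.
Qed.

(** Integrability is bundled with a real value, so means combine without side conditions. *)
Definition has_mean X e :=
  Pr.-integrable [set: T] (EFin \o X) /\ (\int[Pr]_t (X t)%:E)%E = e%:E.

Lemma has_mean_expectation X e : has_mean X e -> ('E_Pr[X] = e%:E)%E.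
Proof. by case=> _; rewrite unlock. Qed.

Lemma has_mean_cst a : has_mean (fun=> a) a.
Proof.
split.
  exact: finite_measure_integrable_cst.
by rewrite integral_cst //= probability_setT mule1.
Qed.

Lemma has_meanD X Y e a : has_mean X e -> has_mean Y a ->
  has_mean (fun t => X t + Y t) (e + a).
Proof.
move=> [iX EX] [iY EY]; split; first exact: (integrableD measurableT iX iY).
by rewrite EFinD -EX -EY -integralD_EFin.
Qed.

Lemma has_meanZ X e a : has_mean X e -> has_mean (fun t => a * X t) (a * e).
Proof.
move=> [iX EX]; split; first exact: (integrableZl measurableT a iX).
rewrite EFinM -EX -integralZl //.
Qed.

Lemma has_mean_sum (I : Type) (r : seq I) (X : I -> T -> R) (e : I -> R) :
  (forall i, has_mean (X i) (e i)) ->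
  has_mean (fun t => \sum_(i <- r) X i t) (\sum_(i <- r) e i).
Proof.
move=> H; elim: r => [|i r IH].
  rewrite big_nil; under eq_fun do rewrite big_nil; exact: has_mean_cst.
rewrite big_cons; under eq_fun do rewrite big_cons; exact: has_meanD.
Qed.

Lemma has_mean_indicator (A : set T) (b : T -> bool) e : measurable A ->
  (forall t, b t <-> A t) -> Pr A = e%:E -> has_mean (fun t => (b t)%:R) e.
Proof.
move=> mA bA PA.
have -> : (fun t => (b t)%:R) = \1_A :> (T -> R).
  apply/funext => t; rewrite indicE; congr (_%:R); congr (nat_of_bool _).
  by apply/idP/idP => [/bA/mem_set|/set_mem/bA].
split; first exact: integrable_indic.
by rewrite integral_indic // setIT.
Qed.

Lemma has_mean_ext X Y e a : has_mean X e -> X = Y -> e = a -> has_mean Y a.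
Proof. by move=> H <- <-. Qed.

End Means.

Section SamplingMean.
Context {dT : measure_display} {T : measurableType dT} {R : realType}.
Variables (Pr : probability T R) (n N : nat) (s : 'I_N -> T -> 'I_n).
Hypotheses (n_gt0 : (0 < n)%N) (N_gt0 : (0 < N)%N).
Hypothesis s_iid : iid_uniform Pr s.

Let dev (l : 'I_n) t : R := N%:R^-1 * (\sum_i (s i t == l)%:R) - n%:R^-1.

(** Off the diagonal this is independence for the index set of [i] and [j]; on it, the indicator is
    idempotent. A single formula for both makes the double sum computable. *)
Lemma has_mean_pair i j l :
  has_mean Pr (fun t => (s i t == l)%:R * (s j t == l)%:R)
    (n%:R^-1 ^+ 2 + (i == j)%:R * (n%:R^-1 - n%:R^-1 ^+ 2)).
Proof.
have [ms ps ind] := s_iid.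
have -> : (fun t => (s i t == l)%:R * (s j t == l)%:R) =
    (fun t => ((s i t == l) && (s j t == l))%:R) :> (T -> R).
  by apply/funext => t; rewrite -natrM mulnb.
apply: (@has_mean_indicator _ _ _ _ ((s i @^-1` [set l]) `&` (s j @^-1` [set l]))).
- exact: measurableI.
- by move=> t; split=> [/andP[/eqP ? /eqP ?]|[/= -> ->]]; rewrite ?eqxx.
have [->|ij] := eqVneq i j; first by rewrite setIid ps mul1r addrC subrK.
have := ind [set i; j]%SET (fun=> [set l]).
rewrite big_setU1 ?inE //= big_set1 !ps mul0r addr0 -EFinM => <-.
congr (Pr _); apply/seteqP; split=> t /=.
  by move=> [si sj] k /=; rewrite !inE => /orP[] /eqP ->.
by move=> H; split; apply: H => /=; rewrite !inE eqxx ?orbT.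
Qed.

Lemma has_mean_single i l : has_mean Pr (fun t => (s i t == l)%:R) n%:R^-1.
Proof.
have [ms ps _] := s_iid.
apply: (@has_mean_indicator _ _ _ _ (s i @^-1` [set l])) => // t.
by split=> [/eqP|/= ->].
Qed.

(** The variance of an average of [N] independent Bernoulli variables with parameter [n%:R^-1]. *)
Lemma has_mean_sqr_dev l :
  has_mean Pr (fun t => dev l t ^+ 2) (N%:R^-1 * (n%:R^-1 - n%:R^-1 ^+ 2)).
Proof.
have N0 : N%:R != 0 :> R by rewrite pnatr_eq0 -lt0n.
have M1 := has_meanZ (N%:R^-1 ^+ 2) (has_mean_sum (index_enum 'I_N) (fun i =>
  has_mean_sum (index_enum 'I_N) (fun j => has_mean_pair i j l))).
have M2 := has_meanZ (- (2 * N%:R^-1 * n%:R^-1))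
  (has_mean_sum (index_enum 'I_N) (fun i => has_mean_single i l)).
have := has_meanD (has_meanD M1 M2) (has_mean_cst Pr (n%:R^-1 ^+ 2)).
move=> /has_mean_ext; apply.
  apply/funext => t; rewrite /dev.
  have -> : \sum_(i < N) \sum_(j < N) (s i t == l)%:R * (s j t == l)%:R =
      (\sum_(i < N) (s i t == l)%:R) ^+ 2 :> R.
    by rewrite expr2 mulr_suml; apply: eq_bigr => i _; rewrite mulr_sumr.
  by move: (\sum_(i < N) _) => Z; ring.
rewrite !sumr_const !card_ord.
have -> : \sum_(i < N) \sum_(j < N) (n%:R^-1 ^+ 2 + (i == j)%:R * (n%:R^-1 - n%:R^-1 ^+ 2)) =
    N%:R ^+ 2 * n%:R^-1 ^+ 2 + N%:R * (n%:R^-1 - n%:R^-1 ^+ 2) :> R.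
  have -> : N%:R ^+ 2 * n%:R^-1 ^+ 2 + N%:R * (n%:R^-1 - n%:R^-1 ^+ 2) =
      \sum_(i < N) (N%:R * n%:R^-1 ^+ 2 + (n%:R^-1 - n%:R^-1 ^+ 2)) :> R.
    by rewrite sumr_const card_ord -mulr_natl; ring.
  apply: eq_bigr => i _; rewrite big_split /= sumr_const card_ord -[_ *+ N]mulr_natl.
  congr (_ + _); rewrite (bigD1 i) //= eqxx mul1r big1 ?addr0 // => j.
  by rewrite eq_sym => /negbTE ->; rewrite mul0r.
by rewrite -[n%:R^-1 *+ N]mulr_natl; move: n%:R^-1 => y; field.
Qed.

(* [|y| <= (c y^2 + 1/c) / 2] reduces the first moment to the variance. *)
Lemma sampling_error_mean (c : R) : 0 < c -> c ^+ 2 <= N%:R ->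
  exists Z e, [/\ has_mean Pr Z e, forall t, sampling_error (s ^~ t) <= Z t &
    e <= n%:R * c^-1].
Proof.
move=> c0 cN.
exists (fun t => \sum_(l < n) (c / 2 * dev l t ^+ 2 + (2 * c)^-1)).
exists (\sum_(l < n) (c / 2 * (N%:R^-1 * (n%:R^-1 - n%:R^-1 ^+ 2)) + (2 * c)^-1)).
split.
- apply: has_mean_sum => l; apply: has_meanD; last exact: has_mean_cst.
  by apply: has_meanZ; exact: has_mean_sqr_dev.
- move=> t; apply: ler_sum => l _; rewrite -/(dev l t) -(real_normK (num_real (dev l t))).
  set y := `|dev l t|.
  rewrite -subr_ge0.
  have -> : c / 2 * y ^+ 2 + (2 * c)^-1 - y = (c * y - 1) ^+ 2 / (2 * c).
    by field; rewrite lt0r_neq0.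
  by rewrite divr_ge0 ?sqr_ge0 // mulr_ge0 // ltW.
have -> : n%:R * c^-1 = \sum_(l < n) c^-1 by rewrite sumr_const card_ord mulr_natl.
apply: ler_sum => l _.
have n1 : n%:R^-1 <= 1 :> R by rewrite invf_le1 ?ltr0n // ler1n.
have n0 : 0 <= n%:R^-1 :> R by rewrite invr_ge0.
have N0 : 0 < N%:R :> R by rewrite ltr0n.
have H : n%:R^-1 - n%:R^-1 ^+ 2 <= 1 :> R by have := sqr_ge0 (n%:R^-1 : R); lra.
have {}H : N%:R^-1 * (n%:R^-1 - n%:R^-1 ^+ 2) <= c^-1 ^+ 2.
  apply: le_trans (_ : N%:R^-1 * 1 <= _); first by rewrite ler_wpM2l // invr_ge0 ltW.
  by rewrite mulr1 exprVn lef_pV2 ?posrE ?exprn_gt0.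
have c2 : 0 <= c / 2 by rewrite divr_ge0 // ltW.
apply: le_trans (lerD (ler_wpM2l c2 H) (lexx _)) _.
rewrite le_eqVlt; apply/orP; left; apply/eqP; field; exact: lt0r_neq0.
Qed.

End SamplingMean.

(** * From the linear rate to the number of evaluations *)

Section Rates.
Context {R : realType}.
Implicit Types (r beta z : R).

Lemma absz_ceil_bounds z : 0 < z -> z <= `|Num.ceil z|%N%:R < z + 1.
Proof.
move=> z0; have c0 : 0 <= Num.ceil z by rewrite ceil_ge0 (lt_trans _ z0) // oppr_lt0.
rewrite natr_absz ger0_norm // ceil_ge /=.
by have := ceilB1_lt z; rewrite intrB; lra.
Qed.

Lemma powR_expR beta z : 0 < 1 - beta -> (1 - beta) `^ z = expR (z * ln (1 - beta)).
Proof. by move=> b0; rewrite /powR gt_eqF. Qed.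

Lemma eta_gt0 r beta : 0 < r < 1 -> 0 < beta < 1 -> 0 < eta r beta.
Proof.
move=> /andP[r0 r1] /andP[b0 b1]; rewrite /eta -[X in 0 < X]mulrNN -invrN divr_gt0 //.
  by rewrite oppr_gt0 ln_lt0 // subr_gt0 r1 gtrBl.
by rewrite oppr_gt0 ln_lt0 // subr_gt0 b1 gtrBl.
Qed.

Lemma eta_lt1 r beta : r < beta -> 0 < beta < 1 -> eta r beta < 1.
Proof.
move=> rb /andP[b0 b1]; rewrite /eta ltr_ndivrMr; last first.
  by rewrite ln_lt0 // subr_gt0 b1 gtrBl.
rewrite mul1r ltr_ln ?posrE ?subr_gt0 //; last by rewrite (lt_trans rb).
by rewrite ltrD2l ltrN2.
Qed.

(** A geometric sum whose bound reproduces itself: adding [2 * w ^+ k.+2] to it multiplies it by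
    [w]. *)
Lemma sum_batch_le (r : R) (b : nat -> nat) (w := (1 - r) ^- 2) k : 0 < r < 1 ->
  (forall i, (b i)%:R <= 2 * w ^+ i.+1) ->
  (\sum_(1 <= i < k.+1) b i)%:R <= 2 / (w - 1) * w ^+ k.+2.
Proof.
move=> /andP[r0 r1] bw; have r1' : 0 < 1 - r by rewrite subr_gt0.
have w1 : 1 < w.
  by rewrite /w invf_gt1 ?exprn_gt0 // exprn_ilt1 // ?ltW // gtrBl.
have w1' : 0 < w - 1 by rewrite subr_gt0.
have w0 : 0 < w by apply: lt_trans w1.
elim: k => [|k IH].
  by rewrite big_geq // mulr_ge0 ?divr_ge0 ?exprn_ge0 // ltW.
rewrite big_nat_recr //= natrD; apply: le_trans (lerD IH (bw _)) _.
rewrite [w ^+ k.+3]exprS le_eqVlt; apply/orP; left; apply/eqP.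
by field; rewrite gt_eqF.
Qed.

Context {dT : measure_display} {T : measurableType dT}.
Variables (Pr : probability T R) (gap : nat -> T -> R).

Lemma linear_rate_weaken A A' beta beta' : A <= A' -> 0 <= A' -> beta' <= beta ->
  beta < 1 -> linear_rate Pr gap A beta -> linear_rate Pr gap A' beta'.
Proof.
move=> AA' A'0 bb b1 H k k1; apply: le_trans (H k k1) _; rewrite lee_fin.
have k0 : 0 <= (k%:R - 1) / 2 :> R by rewrite divr_ge0 // subr_ge0 ler1n.
apply: le_trans (ler_wpM2r (powR_ge0 _ _) AA') _.
rewrite ler_wpM2l // ge0_ler_powR // ?nnegrE ?subr_ge0 ?(ltW b1) //; last by rewrite lerD2l lerN2.
by rewrite (le_trans bb) // ltW.
Qed.

(** Accuracy [eps] is reached at [k] close to [2 * ln (A' / eps) / - lb], at a cost of order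
    [(1 - r) ^- (2 * k)]. One factor 2 of the exponent comes from the half in the rate, the other
    from the square in the batch size. *)
Lemma linear_rate_evaluations (r A beta : R) (b : nat -> nat) :
  0 < r < 1 -> 0 < beta < 1 ->
  (forall i, b i = `|Num.ceil (1 / (1 - r) ^+ (2 * i + 2))|%N) ->
  linear_rate Pr gap A beta -> evaluations_bigO Pr gap b (4 * eta r beta).
Proof.
move=> r01 b01 bE rateA.
have /andP[r0 r1] := r01; have /andP[b0 b1] := b01.
have r1' : 0 < 1 - r by rewrite subr_gt0.
have b1' : 0 < 1 - beta by rewrite subr_gt0.
(* A constant at least 1 keeps [ln (A' / eps)] positive for every [eps] below 1. *)
pose A' := Num.max A 1.
have A'1 : 1 <= A' by rewrite /A' le_max lexx orbT.
have A'0 : 0 < A' by apply: lt_le_trans A'1.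
have rate : linear_rate Pr gap A' beta.
  by apply: linear_rate_weaken rateA => //; rewrite ?(ltW A'0) // /A' le_max lexx.
pose la := ln (1 - r); pose lb := ln (1 - beta).
have la0 : la < 0 by rewrite ln_lt0 // r1' gtrBl.
have lb0 : lb < 0 by rewrite ln_lt0 // b1' gtrBl.
pose w := (1 - r) ^- 2.
have wE : w = expR (- 2 * la).
  rewrite /w -[1 - r]lnK ?posrE // -/la -expRM_natl -expRN; congr expR; ring.
have w1 : 1 < w by rewrite wE expR_gt1; nra.
(* Rounding up at most doubles a number that is at least 1. *)
have bw i : (b i)%:R <= 2 * w ^+ i.+1.
  have -> : w ^+ i.+1 = 1 / (1 - r) ^+ (2 * i + 2).
    by rewrite /w exprVn -exprM mul1r; congr (_ ^- _); lia.
  rewrite bE; set z := 1 / _.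
  have z1 : 1 <= z by rewrite /z mul1r invf_ge1 ?exprn_gt0 // exprn_ile1 // ?ltW // gtrBl.
  have /absz_ceil_bounds/andP[_] : 0 < z by apply: lt_le_trans z1.
  lra.
(* The factor [expR (- 8 * la)] is the fourth power of [w]: it pays for rounding [y] up and for the
   shift in [sum_batch_le]. *)
pose K := 2 / (w - 1) * expR (- 8 * la) * expR (4 * eta r beta * ln A').
exists K, 1; split=> //.
  by rewrite !mulr_gt0 ?expR_gt0 ?invr_gt0 ?subr_gt0.
move=> eps /andP[e0 e1].
pose y := - 2 * ln (A' / eps) / lb.
have l0 : 0 < ln (A' / eps) by rewrite ln_gt0 // ltr_pdivlMr // mul1r (lt_le_trans e1).
have y0 : 0 < y by rewrite /y mulNr mulNr -mulrN -invrN !mulr_gt0 // ?invr_gt0 ?oppr_gt0.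
(* The rate has exponent [(k - 1) / 2], and [k - 1] must exceed [y]. *)
exists (Num.truncn y).+2; split=> //.
  apply: le_trans (rate _ _) _ => //; rewrite lee_fin.
  have epsE : eps / A' = expR (- ln (A' / eps)).
    by rewrite expRN lnK ?posrE ?divr_gt0 // invf_div.
  rewrite powR_expR // mulrC -ler_pdivlMr // epsE ler_expR -/lb.
  have -> : (Num.truncn y).+2%:R - 1 = (Num.truncn y).+1%:R :> R by rewrite [in LHS]mulrS; lra.
  have yl : y * lb = - 2 * ln (A' / eps) by rewrite /y divfK // lt_eqF.
  have := ler_wnM2r (ltW lb0) (ltW (truncnS_gt y)); rewrite yl; lra.
apply: le_trans (sum_batch_le _ r01 bw) _; rewrite -/w.
have kle : (Num.truncn y).+2.+2%:R <= y + 4.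
  have /andP[+ _] := truncn_itv (ltW y0).
  by rewrite -(@lerD2r _ 4) -natrD addn4.
rewrite /K -[leRHS]mulrA -[leRHS]mulrA ler_wpM2l ?divr_ge0 ?subr_ge0 ?(ltW w1) //.
have -> : (1 / eps) `^ (4 * eta r beta) = expR (4 * eta r beta * - ln eps).
  by rewrite /powR mul1r invr_eq0 gt_eqF // lnV.
rewrite -!expRD wE -expRM_natl ler_expR.
have -> : - 8 * la + (4 * eta r beta * ln A' + 4 * eta r beta * - ln eps) =
    (y + 4) * (- 2 * la).
  rewrite /y ln_div ?posrE // /eta -/la -/lb; field; exact: ltr0_neq0.
by rewrite ler_wpM2r //; lra.
Qed.

End Rates.

(** * The linear rate *)

Section LinearRate.
Context {R : realType} {m p n : nat} (C : 'M[R]_(m, p)) (d : 'cV[R]_m).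
Variables (f : 'I_n -> 'cV[R]_p -> R) (sigma L : 'I_n -> R).
Hypothesis n_gt0 : (0 < n)%N.
Hypothesis P_compact : compact (polyhedron C d).
Hypothesis f_convex : forall i, strongly_convex (sigma i) (f i).
Hypothesis f_smooth : forall i, lipschitz_gradient (L i) (f i).
Variable caratheodory : bool.
Context {dT : measure_display} {T : measurableType dT}.
Variable Pr : probability T R.
Variables (Past : nat -> set (set T)) (xi : nat -> nat -> T -> 'I_n).
Variables (x : nat -> T -> 'cV[R]_p) (mu : nat -> T -> 'cV[R]_p -> R).
Hypothesis run : asfw_run Pr C d f sigma L caratheodory Past xi x mu.

Let P := polyhedron C d.
Let r := rho C d sigma L caratheodory.
Let b := batch_size C d sigma L caratheodory.
Let gap k t := objective f (x k t) - optimum f P.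

(** The quadratic bound around one point and the diameter bound each function; the sum over [i]
    dominates all of them. *)
Lemma smooth_bounded : exists B, forall i y, P y -> `|f i y| <= B.
Proof.
have [[y0 Py0]|P0] := pselect (P !=set0); last first.
  by exists 0 => i y Py; exfalso; apply: P0; exists y.
pose D := diameter C d.
pose c i := `|f i y0| + enorm (grad (f i) y0) * D + `|L i| / 2 * D ^+ 2.
have D0 : 0 <= D by apply: le_trans (enorm_le_diameter P_compact Py0 Py0); exact: enorm_ge0.
have c0 i : 0 <= c i by rewrite !addr_ge0 ?mulr_ge0 ?enorm_ge0.
exists (\sum_i c i) => i y Py; apply: le_trans (_ : c i <= _); last first.
  by rewrite (bigD1 i) //= lerDl sumr_ge0.
have yD := enorm_le_diameter P_compact Py Py0.
have := gradient_deviation y0 y (f_smooth i).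
have : L i / 2 * enorm (y - y0) ^+ 2 <= `|L i| / 2 * D ^+ 2.
  apply: le_trans (_ : `|L i| / 2 * enorm (y - y0) ^+ 2 <= _).
    by rewrite ler_wpM2r ?sqr_ge0 // ler_pM2r // ler_norm.
  by rewrite ler_wpM2l ?divr_ge0 // lerXn2r // nnegrE ?enorm_ge0.
have : `|dot (grad (f i) y0) (y - y0)| <= enorm (grad (f i) y0) * D.
  by apply: le_trans (normr_dot _ _) _; rewrite ler_wpM2l ?enorm_ge0.
rewrite /c; set g := dot _ _ => H1 H2 H3.
have -> : f i y = f i y0 + g + (f i y - f i y0 - g) by ring.
apply: le_trans (ler_normD _ _) _; apply: lerD; last exact: le_trans H3 H2.
by apply: le_trans (ler_normD _ _) _; rewrite lerD2l.
Qed.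

Lemma gap_singleton t k : diameter C d = 0 -> (1 <= k)%N -> gap k t = 0.
Proof.
move=> D0 k1.
have [[Px1 _] _] := run_start run t.
have Peq y : P y -> y = x 1%N t by move=> Py; exact: (diameter_eq0 P_compact D0 Py Px1).
have xk : x k t = x 1%N t.
  case: k k1 => // k _; elim: k => [//|k IH].
  have [w [u [gam [[[Pw _] _] [[[Pu _] _] _] _ -> _]]]] := run_step run t (ltn0Sn k).
  rewrite IH (Peq w Pw) (Peq u Pu) subrr.
  by rewrite if_same scaler0 addr0.
rewrite /gap xk /optimum.
have -> : objective f @` P = [set objective f (x 1%N t)].
  apply/seteqP; split=> [_ [y /Peq -> <-] //|_ ->]; by exists (x 1%N t).
by rewrite inf1 subrr.
Qed.

(** The gap vanishes; 3/4 is chosen to exceed the value 1/2 that [rho] takes here. *)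
Lemma linear_rate_singleton : diameter C d = 0 -> linear_rate Pr gap 1 (3 / 4).
Proof.
move=> D0 k k1; have -> : gap k.+1 = fun=> 0.
  by apply/funext => t; exact: gap_singleton.
by rewrite (has_mean_expectation (has_mean_cst Pr 0)) lee_fin mul1r powR_ge0.
Qed.

Hypothesis D_neq0 : diameter C d != 0.

(** A space of total probability 1 has a sample point, and the run starts at a vertex there. *)
Lemma start_vertex : exists v, vertices C d v.
Proof.
have [[t _]|T0] := pselect ([set: T] !=set0).
  by exists (x 1%N t); have [] := run_start run t.
have := probability_setT Pr; have -> : [set: T] = set0.
  by apply/seteqP; split=> // t _; apply: T0; exists t.
by rewrite measure0 => /eqP; rewrite eqe eq_sym oner_eq0.
Qed.

Lemma nonzero_vector : exists v : 'cV[R]_p, v != 0.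
Proof.
have [v [Pv _]] := start_vertex.
have [y _ yv] := diameter_neq0 Pv D_neq0.
by exists (y - v); rewrite subr_eq0; apply/eqP.
Qed.

Lemma rho_bounds_run :
  [/\ 0 < r, r <= 1 / 16 &
      r * (16 * (rep_size C d caratheodory)%:R ^+ 2 * LF L * diameter C d ^+ 2)
        <= Omega C d ^+ 2 * sigmaF sigma].
Proof.
have [v Vv] := start_vertex; have [z z0] := nonzero_vector.
apply: (@rho_bounds _ _ _ _ _ _ _ _ _ _ _ _ _ v) => // i.
  by case: (f_convex i).
exact: (strongly_convex_le_smooth z0 (f_smooth i) (f_convex i)).
Qed.

(** The pathwise bound is taken in mean with [c := beta] and [q] the square root of [1 - beta]. The
    noise of batch [j] has mean of order [(1 - r) ^+ j], so its discounted sum is at most [q ^+ k]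
    times a convergent geometric series. *)
Lemma asfw_linear_rate (beta := 3 / 2 * r) : exists C2, linear_rate Pr gap C2 beta.
Proof.
have [r0 r1 rle] := rho_bounds_run.
have beta0 : 0 < beta by rewrite /beta; lra.
have beta1 : beta <= 1 / 2 by rewrite /beta; lra.
pose q := Num.sqrt (1 - beta).
have q0 : 0 < q by rewrite sqrtr_gt0; lra.
have q_sqr : q ^+ 2 = 1 - beta by rewrite sqr_sqrtr //; lra.
have q1 : q < 1 by rewrite -(ltr_pXn2r (n := 2)) ?nnegrE ?(ltW q0) // expr1n q_sqr; lra.
(* After squaring, [1 - 2 * r + r ^+ 2 < 1 - 3 / 2 * r], true since [r < 1 / 2]. *)
have rq : 1 - r < q.
  rewrite -(ltr_pXn2r (n := 2)) ?nnegrE ?(ltW q0) //; last by lra.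
  by rewrite q_sqr /beta; nra.
have [B fB] := smooth_bounded.
have B0 : 0 <= B.
  have [v [Pv _]] := start_vertex.
  exact: le_trans (normr_ge0 _) (fB (Ordinal n_gt0) v Pv).
have b_ge k : ((1 - r) ^+ k.+1)^-1 ^+ 2 <= (b k)%:R :> R.
  rewrite exprVn -exprM /b /batch_size -/r (_ : (2 * k + 2)%N = (k.+1 * 2)%N); last by lia.
  rewrite mul1r; have /absz_ceil_bounds/andP[//] : 0 < ((1 - r) ^+ (k.+1 * 2))^-1.
  by rewrite invr_gt0 exprn_gt0 //; lra.
have b0 k : (0 < b k)%N.
  rewrite -(@ltr_nat R); apply: lt_le_trans (b_ge k).
  by rewrite exprn_gt0 // invr_gt0 exprn_gt0 //; lra.
(* The factor [3 / 2 * 4 = 6] fits below the 16 in the definition of [rho]. *)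
have c_le : beta * (4 * (rep_size C d caratheodory)%:R ^+ 2 * LF L * diameter C d ^+ 2) <=
    Omega C d ^+ 2 * sigmaF sigma.
  apply: le_trans rle; rewrite /beta.
  have LF0 : 0 <= LF L.
    have [z z0] := nonzero_vector; pose i := Ordinal n_gt0; have [si _] := f_convex i.
    apply: le_trans (le_LF L i); apply/ltW/(lt_le_trans si).
    exact: (strongly_convex_le_smooth z0 (f_smooth i) (f_convex i)).
  set X := (rep_size C d caratheodory)%:R ^+ 2; set Y := diameter C d ^+ 2.
  have X0 : 0 <= X * LF L * Y by apply: mulr_ge0 (mulr_ge0 _ LF0) _; exact: sqr_ge0.
  by have := mulr_ge0 (ltW r0) X0; lra.
pose err j t := sampling_error (fun i : 'I_(b j) => xi j i t) : R.
pose K := 2 * B * q^-1 ^+ rep_size C d caratheodory.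
have K0 : 0 <= K by rewrite !mulr_ge0 // exprn_ge0 // invr_ge0 ltW.
have gap_le k t : 0 <= gap k.+1 t <=
    K * (q ^+ k + \sum_(1 <= j < k.+1) q ^+ (k - j) * err j t).
  have [Vx1 mu1] := run_start run t.
  apply: (@asfw_gap_bound _ _ _ _ C d f sigma L caratheodory n_gt0 f_convex f_smooth
    P_compact B fB beta _ c_le (x ^~ t) (mu ^~ t) b (fun k i => xi k i t)) => //.
  - by rewrite beta0.
  - exact: nonzero_vector.
  - by move=> j; exact: (run_step run t).
(* Integrable majorants of the errors, with their means. Index 0 gets a dummy value to make the
   family total before [choice]. *)
have mean_err j : exists Ze : (T -> R) * R, has_mean Pr Ze.1 Ze.2 /\
    ((1 <= j)%N -> (forall t, err j t <= Ze.1 t) /\ Ze.2 <= n%:R * (1 - r) ^+ j).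
  case: j => [|j]; first by exists (fun=> 0, 0); split=> //; exact: has_mean_cst.
  have r1' : 0 < 1 - r by lra.
  have [||Z [e [ZE Zerr ele]]] := @sampling_error_mean _ _ _ Pr n _ _ n_gt0 (b0 j.+1)
      (samples_iid run (ltn0Sn j)) ((1 - r) ^+ j.+2)^-1.
  - by rewrite invr_gt0 exprn_gt0.
  - exact: b_ge.
  exists (Z, e); split=> // _; split=> //=; apply: le_trans ele _.
  by rewrite invrK; apply: ler_wpM2l => //; apply: ler_wiXn2l => //; lra.
have [Ze HZ] := choice mean_err.
(* The ratio of noise decay to contraction; [rq] makes it less than 1. *)
pose theta := (1 - r) / q.
have theta1 : theta < 1 by rewrite ltr_pdivrMr // mul1r.
have theta0 : 0 <= theta by rewrite divr_ge0 ?(ltW q0) //; lra.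
have geo k : \sum_(1 <= j < k.+1) theta ^+ j <= (1 - theta)^-1.
  rewrite -[leRHS]mul1r ler_pdivlMr ?subr_gt0 //.
  suff -> : (\sum_(1 <= j < k.+1) theta ^+ j) * (1 - theta) = theta - theta ^+ k.+1.
    by apply: le_trans (ltW theta1); rewrite gerBl exprn_ge0.
  elim: k => [|k IH]; first by rewrite big_geq // mul0r expr1 subrr.
  by rewrite big_nat_recr //= mulrDl IH [theta ^+ k.+2]exprS; ring.
have s_ge0 : 0 <= 1 + n%:R * (1 - theta)^-1.
  by rewrite addr_ge0 // mulr_ge0 // invr_ge0 subr_ge0 ltW.
exists (K * (1 + n%:R * (1 - theta)^-1)) => k k1.
have mY := has_meanZ K (has_meanD (has_mean_cst Pr (q ^+ k)) (has_mean_sum (index_iota 1 k.+1)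
  (fun j => has_meanZ (q ^+ (k - j)) (HZ j).1))).
set Y := (fun t => _) in mY; have : ('E_Pr[gap k.+1] <= 'E_Pr[Y])%E.
  apply: le_expectation => t; first by have /andP[] := gap_le k t.
  have /andP[_ H] := gap_le k t; apply: le_trans H _.
  rewrite ler_wpM2l // lerD2l; apply: ler_sum_nat => j /andP[j1 _].
  rewrite ler_wpM2l ?exprn_ge0 ?(ltW q0) //.
  by have [_ /(_ j1)[]] := HZ j.
rewrite (has_mean_expectation mY) => /le_trans; apply; rewrite lee_fin -[leRHS]mulrA ler_wpM2l //.
(* The power [k - 1] of [q] is the right-hand side; the remaining factor [q] is at most 1. *)
have qpow : q ^+ k <= (1 - beta) `^ ((k%:R - 1) / 2).
  have -> : k%:R - 1 = k.-1%:R :> R by rewrite -{1}(prednK k1) mulrS; ring.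
  rewrite mulrC powRrM powR12_sqrt; last by lra.
  rewrite powR_mulrn ?(ltW q0) // -{1}(prednK k1) exprS ler_piMl ?exprn_ge0 ?(ltW q0) //.
  exact: ltW.
apply: le_trans (_ : (1 + n%:R * (1 - theta)^-1) * q ^+ k <= _); last by rewrite ler_wpM2l.
rewrite mulrDl mul1r lerD2l -mulrA [_ * q ^+ k]mulrC mulrA.
apply: le_trans (ler_wpM2l _ (geo k)); last by rewrite mulr_ge0 // exprn_ge0 // ltW.
rewrite mulr_sumr; apply: ler_sum_nat => j /andP[j1 jk].
have [_ /(_ j1)[_ ele]] := HZ j.
apply: le_trans (ler_wpM2l _ ele) _; first by rewrite exprn_ge0 // ltW.
rewrite mulrCA -mulrA ler_wpM2l //.
have -> : q ^+ k = q ^+ (k - j) * q ^+ j by rewrite -exprD subnK.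
by rewrite /theta expr_div_n -mulrA ler_wpM2l ?exprn_ge0 ?(ltW q0) // mulrC divfK // expf_neq0 // gt_eqF.
Qed.

End LinearRate.

(** For [r] and [beta] strictly between 0 and 1, [eta r beta < 1] is equivalent to [r < beta], so
    [beta < r] and [eta r beta < 1] exclude each other. The conclusion therefore has two halves, one
    for each of these conditions. *)
Theorem corollary3 (R : realType) (m p n : nat)
    (C : 'M[R]_(m, p)) (d : 'cV[R]_m)
    (f : 'I_n -> 'cV[R]_p -> R) (sigma L : 'I_n -> R)
    (n_gt0 : (0 < n)%N)
    (P_nonempty : polyhedron C d !=set0)
    (P_compact : compact (polyhedron C d))
    (f_convex : forall i, strongly_convex (sigma i) (f i))
    (f_smooth : forall i, lipschitz_gradient (L i) (f i))
    (caratheodory : bool)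
    (dT : measure_display) (T : measurableType dT) (Pr : probability T R)
    (Past : nat -> set (set T)) (xi : nat -> nat -> T -> 'I_n)
    (x : nat -> T -> 'cV[R]_p) (mu : nat -> T -> 'cV[R]_p -> R)
    (run : asfw_run Pr C d f sigma L caratheodory Past xi x mu) :
  let r := rho C d sigma L caratheodory in
  let b := batch_size C d sigma L caratheodory in
  let gap k t := objective f (x k t) - optimum f (polyhedron C d) in
  (exists C2 beta : R,
    [/\ [/\ 0 < beta, beta < r & r <= 1 / 2],
        linear_rate Pr gap C2 beta,
        0 < eta r beta &
        evaluations_bigO Pr gap b (4 * eta r beta)]) /\
  (exists C2 beta : R,
    [/\ 0 < beta < 1,
        linear_rate Pr gap C2 beta,
        0 < eta r beta < 1 &
        evaluations_bigO Pr gap b (4 * eta r beta)]).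
Proof.
move=> r b gap.
(* A rate with [beta] above [r] gives the second half directly and the first by weakening. *)
have [A [beta [r0 r1 rb b1 rate]]] : exists A beta,
    [/\ 0 < r, r <= 1 / 2, r < beta, beta < 1 & linear_rate Pr gap A beta].
  have [D0|D0] := eqVneq (diameter C d) 0.
    exists 1, (3 / 4); split.
    - by rewrite /r /rho D0 eqxx invr_gt0.
    - by rewrite /r /rho D0 eqxx mul1r.
    - by rewrite /r /rho D0 eqxx; lra.
    - lra.
    - exact: linear_rate_singleton run D0.
  have [r0 r1 _] := rho_bounds_run n_gt0 P_compact f_convex f_smooth run D0.
  have [A rate] := asfw_linear_rate n_gt0 P_compact f_convex f_smooth run D0.
  by exists A, (3 / 2 * r); split=> //; rewrite -/r in r0 r1; lra.
have r01 : 0 < r < 1 by rewrite r0; lra.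
have beta01 : 0 < beta < 1 by rewrite b1 andbT; lra.
split.
  (* Any positive number below [r] would do; the maximum with 1 makes the constant nonnegative, as
     weakening requires. *)
  have b2 : 0 < r / 2 < 1 by rewrite divr_gt0 //=; lra.
  have rate2 : linear_rate Pr gap (Num.max A 1) (r / 2).
    apply: linear_rate_weaken rate; rewrite ?le_max ?lexx ?ler01 ?orbT //; lra.
  exists (Num.max A 1), (r / 2); split=> //.
  - by split=> //; lra.
  - exact: eta_gt0.
  - exact: linear_rate_evaluations rate2.
exists A, beta; split=> //.
- by rewrite eta_gt0 // eta_lt1.
- exact: linear_rate_evaluations rate.
Qed.
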